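(* Let $H$ be a bipartite graph with $h$ vertices and $\ell$ edges that contains a cycle. Let $A,\alpha$ be positive reals such that $\mathrm{ex}(n,H)\leq An^\alpha$ for every $n\in\mathbb{N}$. Then there exists a constant $C=C(\alpha,H)$ such that, with high probability as $n\to\infty$, \[\mathrm{ex}(G(n,p),H)\leq \begin{cases} Cn^{2-\frac{1}{m_2(H)}} & \text{if } p\leq n^{-\frac{1}{m_2(H)}},\\ Cp^{1-\frac{1}{\lambda(\alpha,H)}}n^\alpha & \text{otherwise,}\end{cases}\] where $\lambda(\alpha,H)=\frac{1}{m_2(H)(2-\alpha)}$.
   Context: $G(n,p)$ is the Erdős–Rényi random graph on $[n]$ with each pair present independently with probability $p=p(n)$. $\mathrm{ex}(G(n,p),H)$ is the maximum number of edges of an $H$-free subgraph of $G(n,p)$. $\mathrm{ex}(n,H)$ is the maximum number of edges of an $H$-free $n$-vertex graph. $m_2(H)=\max\{\frac{e(F)-1}{v(F)-2}: F\subseteq H, v(F)>2\}$. *)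

(* Defs.v *)
From HB Require Import structures.
From mathcomp Require Import all_boot all_order all_algebra.
From mathcomp Require Import all_classical all_reals all_analysis.

Set Implicit Arguments.
Unset Strict Implicit.
Unset Printing Implicit Defensive.

Import Order.TTheory GRing.Theory Num.Theory.

Local Open Scope set_scope.
Local Open Scope ring_scope.

Definition pairs (V : finType) (W : {set V}) : {set {set V}} :=
  [set e : {set V} | (e \subset W) && (#|e| == 2%N)].

(* A finite simple graph carries its own vertex set inside the ambient finite
   type V, so that the subgraphs of a graph, including the non-spanning ones,
   are again of type [graph V]. *)
Record graph (V : finType) := Graph {
  graph_val : {set V} * {set {set V}};
  _ : graph_val.2 \subset pairs graph_val.1 }.

HB.instance Definition _ (V : finType) := [isSub for @graph_val V].
HB.instance Definition _ (V : finType) := [Countable of graph V by <:].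
HB.instance Definition _ (V : finType) := [Finite of graph V by <:].

Definition vertices (V : finType) (G : graph V) : {set V} := (graph_val G).1.
Definition edges (V : finType) (G : graph V) : {set {set V}} := (graph_val G).2.

Definition nv (V : finType) (G : graph V) : nat := #|vertices G|.
Definition ne (V : finType) (G : graph V) : nat := #|edges G|.

Definition adj (V : finType) (G : graph V) : rel V :=
  fun x y => [set x; y] \in edges G.

Definition subgraph (V : finType) (F G : graph V) : bool :=
  (vertices F \subset vertices G) && (edges F \subset edges G).

Definition bipartite (V : finType) (G : graph V) : Prop :=
  exists A : {set V}, forall e, e \in edges G -> #|e :&: A| = 1%N.

Definition has_cycle (V : finType) (G : graph V) : Prop :=
  exists s : seq V, (2 < size s)%N /\ ucycle (adj G) s.

(* G contains a (not necessarily induced) copy of H.  Only the values of f on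
   [vertices H] matter. *)
Definition has_copy (U V : finType) (H : graph U) (G : graph V) : bool :=
  [exists f : {ffun U -> V},
    [&& dinjectiveb f (mem (vertices H)),
        f @: vertices H \subset vertices G
      & [forall e in edges H, f @: e \in edges G]]].

Definition free (U V : finType) (H : graph U) (G : graph V) : bool :=
  ~~ has_copy H G.

Definition ex_num (U : finType) (n : nat) (H : graph U) : nat :=
  \max_(G : graph 'I_n | (vertices G == [set: 'I_n]) && free H G) ne G.

Definition ex_in (U V : finType) (G : graph V) (H : graph U) : nat :=
  \max_(F : graph V | subgraph F G && free H F) ne F.

(* Every ratio below is at least -1, so the seed -1 does not affect the maximum
   as soon as H has at least three vertices. *)
Definition m2 (R : realType) (V : finType) (H : graph V) : R :=
  \big[Num.max/-1]_(F : graph V | subgraph F H && (2 < nv F)%N)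
    (((ne F)%:R - 1) / ((nv F)%:R - 2)).

(* For alpha = 2 the convention 0^-1 = 0 gives 1 / lambda = m2 H * (2 - alpha),
   as for every other alpha. *)
Definition lambda (R : realType) (V : finType) (alpha : R) (H : graph V) : R :=
  1 / (m2 R H * (2 - alpha)).

Definition gnp_weight (R : realType) (n : nat) (p : R) (G : graph 'I_n) : R :=
  \prod_(e in pairs [set: 'I_n]) (if e \in edges G then p else 1 - p).

Definition gnp_prob (R : realType) (n : nat) (p : R)
    (Q : graph 'I_n -> bool) : R :=
  \sum_(G : graph 'I_n | (vertices G == [set: 'I_n]) && Q G) gnp_weight p G.

Definition random_turan_bound (R : realType) (V : finType) (H : graph V)
    (alpha C : R) (n : nat) (p : R) : R :=
  if p <= n%:R `^ (- (1 / m2 R H))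
  then C * n%:R `^ (2 - 1 / m2 R H)
  else C * p `^ (1 - 1 / lambda alpha H) * n%:R `^ alpha.

(* Main.v *)
(** First-moment argument.  If G(n,p) contains an H-free subgraph with more than
    M edges then exp(-M) times the sum of (e p)^|I| over all H-free edge sets I
    bounds the probability, so it suffices to bound this generating function by
    exp(O(p e0)), where e0 = B n^alpha p^(-1/lambda) and p e0 is the claimed order.

    Containers: for an edge set D with N >= B n^alpha edges and
    tau = (B n^alpha / N)^lambda, every H-free I contained in D has a fingerprint
    T of size O(tau N) which determines a set of at least delta N edges of D
    missed by I \ T.  Iterating until N falls to about e0 costs a total factor
    exp(O(p e0)), because lambda > 1 makes the successive contributions
    tau N log(p/tau) sum geometrically.

    The balanced supersaturation that containers need comes from sampling: choose
    m so that m-vertex samples of D have typically more than 2 ex(m,H) edges, take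
    in each m-set a maximal family of edge-disjoint copies of H, and count each
    copy once for every m-set that selects it.  A set of j edges on v vertices then
    has degree at most about (m/n)^v, and j - 1 <= m_2(H) (v - 2) turns this into
    the bound tau^(j-1) with tau = (m/n)^(1/m_2(H)).

    The remaining cases are easier: for p <= n^(-1/m_2(H)) or alpha >= 2 the
    number of edges of G(n,p) is small enough, and for lambda <= 1 the bound
    exceeds ex(n,H). *)
Require Import Defs.
From HB Require Import structures.
From mathcomp Require Import all_boot all_order all_algebra.
From mathcomp Require Import all_classical all_reals all_analysis.
From mathcomp Require Import ring lra zify.

Set Implicit Arguments.
Unset Strict Implicit.
Unset Printing Implicit Defensive.

Import Order.TTheory GRing.Theory Num.Theory.
Import numFieldNormedType.Exports.

Local Open Scope ring_scope.

(** * Hypergraph containers *)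

Definition wdeg (R : realFieldType) (E : finType) (G : {set E} -> R)
    (S : {set E}) : R :=
  \sum_(A : {set E} | S \subset A) G A.

Section Scan.
Context (R : realFieldType) (E : finType) (G : {set E} -> R).
Context (c : nat -> R) (theta q : R).
Hypothesis G_ge0 : forall A, 0 <= G A.
Implicit Types (L : {set E} -> R) (A B S T I X : {set E}) (v : E).

(* One pass over the ground set builds a fingerprint T (first component) and the
   weights L, on sets one element smaller, of the links of the elements of T
   (second component).  Edges of G containing a set whose L-degree is already
   large (a saturated set) are ignored, which keeps L spread out.  Since the
   available degrees only decrease, an element of I rejected when it is scanned
   still has small degree at the end. *)
Definition saturated L S := (S != finset.set0) && (c #|S| <= wdeg L S).

Definition available L A :=
  [forall S : {set E}, (S \subset A) ==> ~~ saturated L S].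

Definition adeg L v := \sum_(A : {set E} | (v \in A) && available L A) G A.

Definition link L v B :=
  if (v \notin B) && available L (v |: B)%SET then G (v |: B)%SET else 0.

Definition scan_step I (st : {set E} * ({set E} -> R)) v :=
  if [&& v \in I, v \notin st.1, #|st.1|%:R < q & theta <= adeg st.2 v]
  then ((v |: st.1)%SET, fun B => st.2 B + link st.2 v B) else st.

Definition scan I := foldl (scan_step I) (finset.set0, fun=> 0) (enum E).

Lemma link_ge0 L v B : 0 <= link L v B.
Proof. by rewrite /link; case: ifP. Qed.

Lemma scan_ind I (P : {set E} -> ({set E} -> R) -> Prop) :
  P finset.set0 (fun=> 0) ->
  (forall T L v, P T L -> v \in I -> v \notin T -> #|T|%:R < q ->
     theta <= adeg L v -> P (v |: T)%SET (fun B => L B + link L v B)) ->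
  P (scan I).1 (scan I).2.
Proof.
rewrite /scan => P0 PS; elim/last_ind: (enum E) => [//|s v IH].
rewrite foldl_rcons; set st := foldl _ _ s in IH *.
rewrite /scan_step; case: ifP => // /and4P[vI vT Tq th].
exact: (PS _ _ _ IH vI vT Tq th).
Qed.

Lemma foldl_scan_mono I (st : {set E} * ({set E} -> R)) (s : seq E) :
  (st.1 \subset (foldl (scan_step I) st s).1) /\
  (forall B, st.2 B <= (foldl (scan_step I) st s).2 B).
Proof.
elim: s st => [|v s IH] st //=.
have [h1 h2] := IH (scan_step I st v); split.
  apply: fintype.subset_trans h1; rewrite /scan_step; case: ifP => //= _.
  exact: finset.subsetUr.
move=> B; apply: le_trans (h2 B); rewrite /scan_step; case: ifP => //= _.
by rewrite lerDl link_ge0.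
Qed.

(** The two runs could differ only at an element of I outside X; if accepted from I, it would lie in
    the fingerprint, hence in X. *)
Lemma scan_between I X :
  (scan I).1 \subset X -> X \subset I -> scan X = scan I.
Proof.
rewrite /scan; move: (finset.set0, _) => st; elim: (enum E) st => [//|v s IH] st /= TX XI.
have -> : scan_step X st v = scan_step I st v.
  rewrite /scan_step.
  have [vI|vI] := boolP (v \in I); last by rewrite (contraNF (fintype.subsetP XI v)).
  have [vX|vX] /= := boolP (v \in X); first by [].
  case: ifP => // g; case/negP: vX.
  apply: (fintype.subsetP TX); have [+ _] := foldl_scan_mono I (scan_step I st v) s.
  move/fintype.subsetP; apply; rewrite /scan_step vI /= g /=.
  by rewrite setU11.
exact: IH.
Qed.

Lemma available_anti L L' A :
  (forall B, L B <= L' B) -> available L' A -> available L A.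
Proof.
move=> le /forallP h; apply/forallP => S; apply/implyP => SA.
have /implyP/(_ SA) := h S; apply: contraNN => /andP[S0 cS].
by rewrite /saturated S0 (le_trans cS)// ler_sum.
Qed.

Lemma adeg_anti L L' v :
  (forall B, L B <= L' B) -> adeg L' v <= adeg L v.
Proof.
move=> le; rewrite /adeg [leLHS]big_mkcond [leRHS]big_mkcond ler_sum// => A _.
case: ifP => [/andP[-> /(available_anti le) ->]//|_]; by case: ifP.
Qed.

Lemma scan_low I v : v \in I -> v \notin (scan I).1 -> #|(scan I).1|%:R < q ->
  adeg (scan I).2 v < theta.
Proof.
rewrite /scan; move: (finset.set0, _) => st vI.
have : v \in enum E by rewrite mem_enum.
elim: (enum E) st => [//|u s IH] st; rewrite inE => /orP[/eqP <-{u IH}|vs] /=; last exact: IH.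
set st' := scan_step I st v => vT Tq.
have [h1 h2] := foldl_scan_mono I st' s.
have [k1 k2] := foldl_scan_mono I st [:: v].
have vT' : v \notin st'.1 by apply: contraNN vT; apply: (fintype.subsetP h1).
have vT0 : v \notin st.1 by apply: contraNN vT'; apply: (fintype.subsetP k1).
have Tq0 : #|st.1|%:R < q.
  apply: le_lt_trans Tq; rewrite ler_nat; apply: subset_leq_card.
  exact: fintype.subset_trans k1 h1.
have := vT'; rewrite {1}/st' /scan_step vI vT0 Tq0 /=; case: ifP => [|/negbT].
  by rewrite /= setU11.
rewrite -ltNge => + _; apply: le_lt_trans; apply: adeg_anti => B.
exact: le_trans (k2 B) (h2 B).
Qed.

End Scan.

(** * Degrees and total weight of the links *)

Section ScanDegrees.
Context (R : realFieldType) (E : finType) (G : {set E} -> R).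
Context (c : nat -> R) (theta q : R).
Hypothesis G_ge0 : forall A, 0 <= G A.
Implicit Types (L : {set E} -> R) (A B S T I X : {set E}) (v : E).

Local Notation adeg := (adeg G c).
Local Notation link := (link G c).
Local Notation scan := (scan G c theta q).

Lemma wdeg_set0 L : wdeg L finset.set0 = \sum_A L A.
Proof. by apply: eq_bigl => A; rewrite finset.sub0set. Qed.

Lemma wdegD L L' S : wdeg (fun B => L B + L' B) S = wdeg L S + wdeg L' S.
Proof. exact: big_split. Qed.

Lemma wdeg_link L v S : wdeg (link L v) S =
  \sum_(A : {set E} | [&& v \in A, available c L A, v \notin S & S \subset A]) G A.
Proof.
rewrite /wdeg /link -big_mkcondr/=.
rewrite (reindex_onto (fun A => A :\ v) (fun B => v |: B)%SET)/=; last first.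
  by move=> B /and3P[_ vB _]; rewrite finset.setU1K.
apply: eq_big => A.
  rewrite !inE eqxx /= finset.subsetD1.
  have [vA|vA] := boolP (v \in A).
    rewrite finset.setD1K// eqxx andbT; case: (available _ _ _); case: (v \notin S) => //=;
    by rewrite ?andbF ?andbT.
  have -> : (v |: A :\ v)%SET == A = false.
    by apply: contraNF vA => /eqP <-; rewrite setU11.
  by rewrite andbF.
by move=> /andP[_ /eqP ->].
Qed.

Lemma mass_link L v : \sum_B link L v B = adeg L v.
Proof.
rewrite -wdeg_set0 wdeg_link; apply: eq_bigl => A.
by rewrite finset.in_set0 finset.sub0set !andbT.
Qed.

Lemma wdeg_link_sat L v S : saturated c L S -> wdeg (link L v) S = 0.
Proof.
move=> sS; rewrite wdeg_link big_pred0// => A.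
apply/negP => /and4P[_ /forallP/(_ S)/implyP av _ SA].
by have := av SA; rewrite sS.
Qed.

Lemma wdeg_link_in L v S : v \in S -> wdeg (link L v) S = 0.
Proof. by move=> vS; rewrite wdeg_link big_pred0// => A; rewrite vS/= !andbF. Qed.

Lemma wdeg_link_le L v S : wdeg (link L v) S <= wdeg G (v |: S)%SET.
Proof.
rewrite wdeg_link /wdeg [leLHS]big_mkcond [leRHS]big_mkcond ler_sum// => A _.
case: ifP => [/and4P[vA _ _ SA]|_]; last by case: ifP.
by rewrite finset.subUset finset.sub1set vA SA.
Qed.

Lemma adeg_le L v : adeg L v <= wdeg G [set v]%SET.
Proof.
rewrite -mass_link -wdeg_set0; apply: le_trans (wdeg_link_le _ _ _) _.
by rewrite finset.setU0.
Qed.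

Lemma scan_sub I : (scan I).1 \subset I.
Proof.
apply: (@scan_ind _ _ G c theta q I (fun T _ => T \subset I)) => [|T L v TI vI _ _ _].
  exact: finset.sub0set.
by rewrite finset.subUset finset.sub1set vI.
Qed.

Lemma scan_card I : 0 <= q -> #|(scan I).1|%:R <= q + 1.
Proof.
move=> q0.
apply: (@scan_ind _ _ G c theta q I (fun T _ => #|T|%:R <= q + 1)).
  by rewrite cards0 addr_ge0.
by move=> T L v _ _ vT Tq _; rewrite cardsU1 vT natrD addrC lerD2r ltW.
Qed.

Lemma scan_ge0 I B : 0 <= (scan I).2 B.
Proof.
apply: (@scan_ind _ _ G c theta q I (fun _ L => 0 <= L B)) => //.
by move=> T L v L0 *; rewrite addr_ge0// link_ge0.
Qed.

Lemma scan_supp I B : (scan I).2 B != 0 ->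
  exists v, [/\ v \in (scan I).1, v \notin B & G (v |: B)%SET != 0].
Proof.
apply: (@scan_ind _ _ G c theta q I (fun T L => L B != 0 ->
  exists v, [/\ v \in T, v \notin B & G (v |: B)%SET != 0])); first by rewrite eqxx.
move=> T L v IH vI _ _ _.
have [LB|LB _] := eqVneq (L B) 0.
  rewrite LB add0r /link; case: ifP => [/andP[vB _] GB|]; last by rewrite eqxx.
  by exists v; rewrite setU11.
by have [w [wT wB Gw]] := IH LB; exists w; rewrite in_setU1 wT orbT.
Qed.

Lemma scan_mass_ge I : theta * #|(scan I).1|%:R <= \sum_B (scan I).2 B.
Proof.
apply: (@scan_ind _ _ G c theta q I (fun T L => theta * #|T|%:R <= \sum_B L B)).
  by rewrite cards0 mulr0 sumr_ge0.
move=> T L v IH _ vT _ th; rewrite big_split/= mass_link cardsU1 vT natrD mulrDr mulr1.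
by rewrite addrC lerD.
Qed.

Lemma scan_mass_le I M : (forall v, wdeg G [set v]%SET <= M) ->
  \sum_B (scan I).2 B <= #|(scan I).1|%:R * M.
Proof.
move=> GM.
apply: (@scan_ind _ _ G c theta q I (fun T L => \sum_B L B <= #|T|%:R * M)).
  by rewrite cards0 mul0r big1.
move=> T L v IH _ vT _ _; rewrite big_split/= mass_link cardsU1 vT natrD mulrDl mul1r.
by rewrite addrC lerD// (le_trans (adeg_le _ _)).
Qed.

(** Once S is saturated, later links contribute nothing to its degree; the last link before that
    adds at most one more threshold. *)
Lemma scan_wdeg I S : S != finset.set0 -> 0 <= c #|S| ->
  (forall v, v \notin S -> wdeg G (v |: S)%SET <= c #|S|) ->
  wdeg (scan I).2 S <= c #|S| *+ 2.
Proof.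
move=> S0 c0 Gc.
apply: (@scan_ind _ _ G c theta q I (fun _ L => wdeg L S <= c #|S| *+ 2)).
  by rewrite /wdeg big1// mulrn_wge0.
move=> T L v IH _ _ _ _; rewrite wdegD.
have [sS|nS] := boolP (saturated c L S); first by rewrite wdeg_link_sat// addr0.
have [vS|vS] := boolP (v \in S); first by rewrite wdeg_link_in// addr0.
rewrite mulr2n lerD//; last exact: le_trans (wdeg_link_le _ _ _) (Gc _ vS).
by move: nS; rewrite /saturated S0/= -ltNge => /ltW.
Qed.

(* A set that is not available contains a saturated set, and the total degree
   of L over all sets bounds how many sets can be saturated. *)
Lemma unavailable_mass L s (r : R) : 0 <= r ->
  (forall B, 0 <= L B) -> (forall B, L B != 0 -> #|B| = s) ->
  (forall S, S != finset.set0 -> wdeg G S <= r * c #|S|) ->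
  \sum_(A | ~~ available c L A) G A <= r * (2 ^+ s * \sum_B L B).
Proof.
move=> r0 L0 Ls Gr.
apply: (@le_trans _ _ (\sum_(S | saturated c L S) wdeg G S)).
  rewrite /wdeg (exchange_big_dep xpredT)//= [leLHS]big_mkcond/= ler_sum// => A _.
  case: ifP => [/forallPn[S]|_]; last exact: sumr_ge0.
  rewrite negb_imply negbK => /andP[SA sS].
  rewrite (bigD1 S)/= ?sS ?SA// lerDl; exact: sumr_ge0.
apply: (@le_trans _ _ (\sum_S r * wdeg L S)).
  rewrite [leLHS]big_mkcond/= ler_sum// => S _.
  case: ifP => [/andP[S0 cS]|_]; last by rewrite mulr_ge0// sumr_ge0.
  by apply: le_trans (Gr _ S0) _; rewrite ler_wpM2l.
rewrite -mulr_sumr ler_wpM2l// /wdeg (exchange_big_dep xpredT)//= mulr_sumr.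
apply: ler_sum => B _; rewrite sumr_const.
have [->|LB] := eqVneq (L B) 0; first by rewrite mul0rn mulr0.
rewrite -[in leLHS]mulr_natl -(Ls _ LB) -natrX -card_powerset.
by rewrite (eq_card (B := powerset B))// => S; rewrite !inE.
Qed.

End ScanDegrees.

(** * Container lemma for weighted hypergraphs *)

Ltac positivity := try (apply: ltW); repeat first
  [ assumption | done | apply: mulr_gt0 | rewrite invr_gt0 | apply: exprn_gt0
  | apply: powR_gt0 | apply: expR_gt0 ].

(** The codegree condition of the container method: for total weight about W on N points, W / N is
    the average degree up to a constant, and each further point of S gains a factor tau. *)
Definition spread (R : realFieldType) (E : finType) (K W tau N : R)
    (G : {set E} -> R) :=
  forall S : {set E}, S != finset.set0 ->
    wdeg G S <= K * W * tau ^+ #|S|.-1 / N.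

Definition uniform_on (R : realFieldType) (E : finType) (G : {set E} -> R)
    (D : {set E}) (s : nat) :=
  forall A : {set E}, G A != 0 -> A \subset D /\ #|A| = s.

Definition independent (R : realFieldType) (E : finType) (G : {set E} -> R)
    (I : {set E}) := forall A : {set E}, G A != 0 -> ~~ (A \subset I).

(* Rm X is the part of D discarded once the fingerprint is known.  It is only
   required to be right for every X between the fingerprint T and I, which is
   what lets fingerprints of successive levels be merged into their union. *)
Definition has_containers (R : realFieldType) (E : finType)
    (P : {set E} -> Prop) (D : {set E}) (t r : R) :=
  exists Rm : {set E} -> {set E}, forall I : {set E}, P I ->
    exists T : {set E}, [/\ T \subset I, #|T|%:R <= t
      & forall X : {set E}, T \subset X -> X \subset I ->
          [/\ Rm X \subset D, r <= #|Rm X|%:R & [disjoint I :\: T & Rm X]]].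

Lemma high_degree_card (R : realFieldType) (E : finType) (D : {set E})
    (d : E -> R) (theta M : R) :
  0 <= theta -> (forall v, d v <= M) -> (forall v, v \notin D -> d v = 0) ->
  \sum_v d v <= theta * #|D|%:R + #|[set v in D | theta <= d v]%SET|%:R * M.
Proof.
move=> th0 dM dD.
rewrite (bigID (mem [set v in D | theta <= d v]%SET))/= addrC lerD//.
  apply: (@le_trans _ _ (\sum_(v in D) theta)); last first.
    by rewrite sumr_const mulr_natr.
  rewrite [leLHS]big_mkcond [leRHS]big_mkcond ler_sum// => v _.
  rewrite inE; case: (boolP (v \in D)) => [_|/dD ->] /=; last by rewrite lexx.
  by case: ifP => //; rewrite -ltNge => /ltW.
by rewrite mulr_natl -sumr_const ler_sum.
Qed.

Section Step.
Context (R : realFieldType) (E : finType) (D : {set E}) (G : {set E} -> R).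
Context (s : nat) (K W tau N : R).
Hypotheses (K1 : 1 <= K) (W0 : 0 < W) (tau0 : 0 < tau) (N0 : 0 < N).
Hypotheses (DN : #|D|%:R <= N) (G0 : forall A, 0 <= G A).
Hypotheses (Gs : uniform_on G D s.+1) (GW : W <= \sum_A G A).
Hypothesis (Gspread : spread K W tau N G).

Let K' := 2 ^+ s.+2 * K ^+ 2.
Let c j := K' * W * tau ^+ j / N / 2.
Let theta := W / N / 4.
Let q := tau * N.
Let scan := scan G c theta q.

Let K0 : 0 < K. Proof. exact: lt_le_trans K1. Qed.
Let K'0 : 0 < K'. Proof. by rewrite mulr_gt0 ?exprn_gt0. Qed.
Let q0 : 0 < q. Proof. exact: mulr_gt0. Qed.
Let theta0 : 0 < theta. Proof. by rewrite !divr_gt0. Qed.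

Let KK' : 2 * K <= K'.
Proof.
have -> : K' = 4 * (2 ^+ s * K ^+ 2) by rewrite /K' !exprS; ring.
have h1 : K <= K ^+ 2 by rewrite expr2 ler_peMl// ltW.
have : K ^+ 2 <= 2 ^+ s * K ^+ 2.
  by rewrite ler_peMl ?exprn_ege1 ?ler1n// exprn_ge0// ltW.
by move: h1 K0; lra.
Qed.

Let G1 v : wdeg G [set v]%SET <= K * W / N.
Proof.
apply: le_trans (Gspread _) _; last by rewrite cards1 expr0 mulr1.
by apply/set0Pn; exists v; rewrite inE.
Qed.

Lemma scan_uniform I : uniform_on (scan I).2 D s.
Proof.
move=> B /scan_supp[v [_ vB /Gs[]]]; rewrite finset.subUset cardsU1 vB => /andP[_ ->].
by case.
Qed.

Lemma scan_independent I : independent G I -> independent (scan I).2 I.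
Proof.
move=> indI B /scan_supp[v [vT vB /indI]]; apply: contraNN => BI.
by rewrite finset.subUset finset.sub1set BI (fintype.subsetP (scan_sub _ _ _ _ _) _ vT).
Qed.

(** Saturation caps the degree of S at twice c(|S|); one factor tau of that cap is absorbed by the
    smaller total weight tau * W / 4. *)
Lemma scan_spread I : spread (4 * K') (tau * W / 4) tau N (scan I).2.
Proof.
move=> S S0.
have Sc : (0 < #|S|)%N by rewrite card_gt0.
have cge j : 0 <= c j.
  by rewrite /c; positivity.
have Gc v : v \notin S -> wdeg G (v |: S)%SET <= c #|S|.
  move=> vS; apply: le_trans (Gspread _) _.
    by apply/set0Pn; exists v; rewrite setU11.
  rewrite cardsU1 vS add1n /= /c.
  have -> : K' * W * tau ^+ #|S| / N / 2 = (K' / 2) * (W * tau ^+ #|S| / N).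
    by field; rewrite gt_eqF.
  have -> : K * W * tau ^+ #|S| / N = K * (W * tau ^+ #|S| / N).
    by field; rewrite gt_eqF.
  rewrite ler_wpM2r//; last by move: KK'; lra.
  by positivity.
apply: le_trans (@scan_wdeg _ _ G c theta q G0 I S S0 (cge _) Gc) _.
rewrite /c -{1}(prednK Sc) exprS; set T := tau ^+ _.
by rewrite le_eqVlt; apply/orP; left; apply/eqP; field; rewrite gt_eqF.
Qed.

Lemma scan_full I : q <= #|(scan I).1|%:R ->
  tau * W / 4 <= \sum_B (scan I).2 B.
Proof.
move=> qT; apply: le_trans (scan_mass_ge _ _ _ _ _).
apply: (@le_trans _ _ (theta * q)); last by rewrite ler_wpM2l// ltW.
by rewrite le_eqVlt; apply/orP; left; apply/eqP; rewrite /theta /q; field; rewrite gt_eqF.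
Qed.

(** The set discarded when the fingerprint is not full: elements of I outside the fingerprint then
    have degree below [theta]. *)
Definition low_removed I :=
  [set v in D | theta <= adeg G c (scan I).2 v]%SET.

(** Available edges keep weight at least W / 2, low-degree elements account for at most W / 4 of the
    degree sum, and every other element for at most K * W / N. *)
Lemma low_removed_card I : #|(scan I).1|%:R < q ->
  N / (4 * K) <= #|low_removed I|%:R.
Proof.
move=> Tq; set L := (scan I).2.
have L0 : forall B, 0 <= L B by move=> B; apply: scan_ge0.
have mL : \sum_B L B <= tau * K * W.
  apply: le_trans (scan_mass_le _ _ _ _ _ G1) _ => //.
  apply: (@le_trans _ _ (q * (K * W / N))).
    by rewrite ler_wpM2r ?(ltW Tq)//; positivity.
  by rewrite le_eqVlt; apply/orP; left; apply/eqP; rewrite /q; field; rewrite gt_eqF.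
have un : \sum_(A | ~~ available c L A) G A <= W / 2.
  have r0 : 0 <= 2 * K / (K' * tau).
    by positivity.
  apply: le_trans (@unavailable_mass _ _ G c G0 L s _ r0 L0 _ _) _.
  - by move=> B LB; have [_ ->] := scan_uniform LB.
  - move=> S S0; apply: le_trans (Gspread S0) _.
    have Sc : (0 < #|S|)%N by rewrite card_gt0.
    rewrite /c -[in leRHS](prednK Sc) exprS; set T := tau ^+ _.
    rewrite le_eqVlt; apply/orP; left; apply/eqP; field.
    by rewrite !gt_eqF.
  - apply: (@le_trans _ _ (2 * K / (K' * tau) * (2 ^+ s * (tau * K * W)))).
      by rewrite !ler_wpM2l// exprn_ge0.
    rewrite le_eqVlt; apply/orP; left; apply/eqP; rewrite /K' !exprS.
    by field; rewrite !gt_eqF// exprn_gt0.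
have av : W / 2 <= \sum_v adeg G c L v.
  rewrite /adeg (exchange_big_dep (available c L))/=; last by move=> v A _ /andP[].
  apply: (@le_trans _ _ (\sum_(A | available c L A) G A)).
    by move: GW; rewrite (bigID (available c L))/=; lra.
  apply: ler_sum => A avA.
  rewrite (eq_bigl (mem A)); last by move=> v; rewrite avA andbT.
  rewrite sumr_const; have [->|GA] := eqVneq (G A) 0; first by rewrite mul0rn.
  have [_ ->] := Gs GA.
  by rewrite -[leLHS]mulr1n ler_wpMn2l.
have d1 v : adeg G c L v <= K * W / N by exact: le_trans (adeg_le _ _ _ _) (G1 v).
have d2 v : v \notin D -> adeg G c L v = 0.
  move=> vD; rewrite /adeg big1// => A /andP[vA _]; apply/eqP/negPn/negP => /Gs[AD _].
  by case/negP: vD; apply: (fintype.subsetP AD).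
have hd := high_degree_card (ltW theta0) d1 d2.
have thD : theta * #|D|%:R <= W / 4.
  apply: (@le_trans _ _ (theta * N)); first by rewrite ler_wpM2l// ltW.
  by rewrite le_eqVlt; apply/orP; left; apply/eqP; rewrite /theta; field; rewrite gt_eqF.
have : W / 4 <= #|low_removed I|%:R * (K * W / N).
  by rewrite /low_removed; move: hd av thD; set x := _ * (K * W / N); lra.
rewrite -ler_pdivrMr; last by rewrite !mulr_gt0 ?invr_gt0.
apply: le_trans; rewrite le_eqVlt; apply/orP; left; apply/eqP; field.
by rewrite !gt_eqF.
Qed.

Lemma low_removed_disjoint I : #|(scan I).1|%:R < q ->
  [disjoint I :\: (scan I).1 & low_removed I].
Proof.
move=> Tq; rewrite -setI_eq0; apply/eqP/setP => v; rewrite !inE.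
apply/negP => /andP[/andP[vT vI] /andP[_]].
by rewrite leNgt (scan_low G0 vI vT Tq).
Qed.

End Step.

(** Induction on the uniformity. A full fingerprint leaves a link weight that is again spread, with
    uniformity one lower; otherwise many high-degree elements can be discarded. Each level adds at
    most tau * N + 1 fingerprint elements. *)
Lemma hypergraph_container (R : realFieldType) (s : nat) (K : R) : 1 <= K ->
  exists2 delta : R, 0 < delta &
    forall (E : finType) (D : {set E}) (G : {set E} -> R) (W tau N : R),
      0 < W -> 0 < tau -> 0 < N -> #|D|%:R <= N -> (forall A, 0 <= G A) ->
      uniform_on G D s -> W <= \sum_A G A -> spread K W tau N G ->
      has_containers (independent G) D (s%:R * (tau * N + 1)) (delta * N).
Proof.
elim: s K => [|s IH] K K1.
  (* A positive total weight on 0-element sets charges the empty set, which lies in every I, so no I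
     is independent. *)
  exists 1 => // E D G W tau N W0 _ _ _ G0 Gs GW _.
  exists (fun=> finset.set0) => I indI; exfalso.
  have [G00|/indI] := eqVneq (G finset.set0) 0; last by rewrite finset.sub0set.
  move: GW; rewrite big1 => [|A _]; first by rewrite leNgt W0.
  have [//|GA] := eqVneq (G A) 0.
  by have [_ /cards0_eq A0] := Gs _ GA; move: GA; rewrite A0 G00 eqxx.
set K' := 2 ^+ s.+2 * K ^+ 2.
have K'1 : 1 <= 4 * K'.
  have h1 : 1 <= 2 ^+ s.+2 :> R by rewrite exprn_ege1// ler1n.
  have h2 : 1 <= K ^+ 2 by rewrite exprn_ege1.
  by rewrite /K'; move: h1 h2; set x := _ ^+ s.+2; set y := K ^+ 2; nra.
have [d d0 Hd] := IH _ K'1.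
have K0 : 0 < K by exact: lt_le_trans K1.
exists (Num.min d (1 / (4 * K))); first by rewrite lt_min d0 divr_gt0// mulr_gt0.
move=> E D G W tau N W0 tau0 N0 DN G0 Gs GW Gsp.
set c := fun j => K' * W * tau ^+ j / N / 2.
pose sc := scan G c (W / N / 4) (tau * N).
have q0 : 0 < tau * N by rewrite mulr_gt0.
(* The discarded set may depend on X only. The inductive removal map is therefore chosen as a
   function of the link weight, which X determines by [scan_between]. *)
have /boolp.choice[F HF] : forall L : {set E} -> R, exists Rm : {set E} -> {set E},
    (exists2 I, L = (sc I).2 & tau * N <= #|(sc I).1|%:R) ->
    forall I, independent L I ->
    exists T : {set E}, [/\ T \subset I, #|T|%:R <= s%:R * (tau * N + 1)
      & forall X : {set E}, T \subset X -> X \subset I ->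
          [/\ Rm X \subset D, d * N <= #|Rm X|%:R & [disjoint I :\: T & Rm X]]].
  move=> L; have [[I0 LI0 full]|nL] :=
    pselect (exists2 I, L = (sc I).2 & tau * N <= #|(sc I).1|%:R); last first.
    by exists (fun=> finset.set0) => /nL.
  have [||||||||Rm HRm] := Hd E D L (tau * W / 4) tau N => //.
  - by rewrite !mulr_gt0// invr_gt0.
  - by move=> A; rewrite LI0; apply: scan_ge0.
  - by rewrite LI0; apply: scan_uniform.
  - by rewrite LI0; apply: scan_full.
  - by rewrite LI0; apply: scan_spread.
  - by exists Rm.
exists (fun X => if tau * N <= #|(sc X).1|%:R then F (sc X).2 X
                 else low_removed D G s K W tau N X) => I indI.
have [full|low] := leP (tau * N) #|(sc I).1|%:R.
  have [|T2 [T2I T2c HT2]] := HF (sc I).2 _ I (scan_independent indI).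
    by exists I.
  exists ((sc I).1 :|: T2)%SET; split.
  - by rewrite finset.subUset T2I scan_sub.
  - have := scan_card G c (W / N / 4) I (ltW q0); rewrite -/sc => h.
    have : (#|((sc I).1 :|: T2)%SET|%:R : R) <= #|(sc I).1|%:R + #|T2|%:R.
      by rewrite -natrD ler_nat; apply: leq_card_setU.
    by rewrite -natr1 mulrDl mul1r; move: h T2c; lra.
  - move=> X; rewrite finset.subUset => /andP[TX T2X] XI.
    have eX : sc X = sc I by apply: scan_between.
    rewrite eX full.
    have [h1 h2 h3] := HT2 X T2X XI; split => //.
      apply: le_trans h2; rewrite ler_wpM2r ?(ltW N0)//.
      by rewrite ge_min lexx.
    apply: disjointWl h3; apply: finset.setDS; exact: finset.subsetUr.
exists (sc I).1; split; first exact: scan_sub.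
  have := scan_card G c (W / N / 4) I (ltW q0); rewrite -/sc => h.
  apply: le_trans h _; rewrite -natr1 mulrDl mul1r lerDr mulr_ge0//.
  by rewrite addr_ge0// ltW.
move=> X TX XI; have eX : sc X = sc I by apply: scan_between.
have low' : #|(sc X).1|%:R < tau * N by rewrite eX.
rewrite eX leNgt low /=; split.
- by apply/fintype.subsetP => v; rewrite inE => /andP[].
- apply: (@le_trans _ _ (N / (4 * K))); last exact: low_removed_card.
  rewrite mulrC; rewrite ler_wpM2l ?(ltW N0)//.
  by rewrite ge_min mul1r lexx orbT.
- have := @low_removed_disjoint _ _ D G s K W tau N G0 I low.
  by rewrite /low_removed -/K' -/c -/(sc X) -/(sc I) eX.
Qed.
(** * Generating functions of hereditary families *)

Definition gen_fun (R : realType) (E : finType) (P : pred {set E}) (x : R)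
    (D : {set E}) : R :=
  \sum_(I : {set E} | (I \subset D) && P I) x ^+ #|I|.

Section GeneratingFunction.
Context (R : realType) (E : finType).
Implicit Types (x : R) (D T I : {set E}) (P : pred {set E}).

Lemma sum_expr_card x D :
  \sum_(T : {set E} | T \subset D) x ^+ #|T| = (1 + x) ^+ #|D|.
Proof.
rewrite -prodr_const [LHS]big_mkcond [RHS]big_mkcond/=.
transitivity (\prod_i ((if i \in D then x else 0) + 1)); last first.
  by apply: eq_bigr => i _; case: ifP => _; rewrite ?add0r// addrC.
rewrite bigA_distr; apply: eq_bigr => T _.
case: ifP => [TD|/negbT/subsetPn[i iT iD]].
  rewrite -prodr_const [LHS]big_mkcond; apply: eq_bigr => i _.
  by case: ifP => // iT; rewrite (fintype.subsetP TD).
by rewrite (bigD1 i)//= iT (negbTE iD) mul0r.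
Qed.

Lemma gen_fun_le P x D : 0 <= x -> gen_fun P x D <= expR (x * #|D|%:R).
Proof.
move=> x0; apply: (@le_trans _ _ ((1 + x) ^+ #|D|)).
  rewrite -sum_expr_card /gen_fun [leLHS]big_mkcond [leRHS]big_mkcond.
  apply: ler_sum => I _; case: (I \subset D) => //=.
  by case: (P I); rewrite ?exprn_ge0.
rewrite mulrC expRM_natl lerXn2r ?nnegrE ?expR_ge0 ?expR_ge1Dx//.
by rewrite addr_ge0.
Qed.

(** I is recovered from its fingerprint T and the rest of I, which lies in D minus [Rm T] and still
    satisfies P. The sum over fingerprints is bounded by an exponential tilt with free parameter
    q. *)
Lemma gen_fun_step P x D (t r q B : R) :
  0 <= x -> 0 <= q -> (forall I T, P I -> T \subset I -> P T) ->
  has_containers (fun I => P I) D t r ->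
  (forall D', D' \subset D -> #|D'|%:R <= #|D|%:R - r -> gen_fun P x D' <= B) ->
  0 <= B ->
  gen_fun P x D <= expR (q * t + x * expR (- q) * #|D|%:R) * B.
Proof.
move=> x0 q0 her [Rm HRm] HB B0.
apply: (@le_trans _ _ (\sum_(T : {set E} | (T \subset D) && (#|T|%:R <= t)) x ^+ #|T| * B)).
  pose ok (T I : {set E}) := [&& T \subset I, #|T|%:R <= t, Rm T \subset D,
     r <= #|Rm T|%:R & [disjoint I :\: T & Rm T]].
  apply: (@le_trans _ _ (\sum_(I : {set E} | (I \subset D) && P I)
     \sum_(T : {set E} | ok T I) x ^+ #|I|)).
    apply: ler_sum => I /andP[ID PI].
    (* Taking X = T makes the discarded set depend on the fingerprint alone. *)
    have [T [TI Tt /(_ T (fintype.subxx T) TI)[h1 h2 h3]]] := HRm I PI.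
    rewrite (bigD1 T)/=; last by rewrite /ok TI Tt h1 h2 h3.
    by rewrite lerDl sumr_ge0// => ? _; rewrite exprn_ge0.
  rewrite (exchange_big_dep (fun T : {set E} => (T \subset D) && (#|T|%:R <= t)))/=;
    last first.
    by move=> I T /andP[ID _] /and5P[TI -> _ _ _]; rewrite andbT (fintype.subset_trans TI).
  apply: ler_sum => T /andP[TD Tt].
  have [/andP[h1 h2]|h] := boolP ((Rm T \subset D) && (r <= #|Rm T|%:R)); last first.
    rewrite big_pred0 ?mulr_ge0 ?exprn_ge0// => I.
    apply/negP => /andP[_ /and5P[_ _ h1 h2 _]].
    by rewrite h1 h2 in h.
  apply: (@le_trans _ _ (x ^+ #|T| * gen_fun P x (D :\: Rm T))); last first.
    rewrite ler_wpM2l ?exprn_ge0// HB ?subsetDl//.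
    rewrite cardsD (finset.setIidPr h1) natrB ?subset_leq_card//.
    by rewrite lerD2l lerN2.
  set S := [set I : {set E} | ((I \subset D) && P I) && ok T I]%SET.
  have hinj : {in S &, injective (fun I => I :\: T)}.
    move=> I J; rewrite !inE => /andP[_ /and5P[TI _ _ _ _]] /andP[_ /and5P[TJ _ _ _ _]].
    by move=> eIJ; rewrite -(setID I T) -(setID J T) (finset.setIidPr TI) (finset.setIidPr TJ) eIJ.
  rewrite (eq_bigl (mem S)); last by move=> I; rewrite !inE.
  rewrite (eq_bigr (fun I => x ^+ #|T| * x ^+ #|I :\: T|)); last first.
    move=> I; rewrite !inE => /andP[_ /and5P[TI _ _ _ _]].
    by rewrite -exprD cardsDS// subnKC// subset_leq_card.
  rewrite -mulr_sumr ler_wpM2l ?exprn_ge0//.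
  rewrite -(big_imset (fun J : {set E} => x ^+ #|J|) hinj)/= /gen_fun.
  rewrite [leLHS]big_mkcond [leRHS]big_mkcond; apply: ler_sum => J _.
  case: ifP => [/imsetP[I + ->]|_]; last by case: ifP; rewrite ?exprn_ge0.
  rewrite !inE => /andP[/andP[ID PI] /and5P[TI _ _ _ dis]].
  rewrite (her I)// ?finset.subsetDl// andbT finset.subsetD dis andbT.
  by rewrite (fintype.subset_trans _ ID)// finset.subsetDl.
rewrite -mulr_suml ler_wpM2r//.
(* For |T| <= t the factor exp(q * (t - |T|)) is at least 1; inserting it removes the size
   restriction, and the binomial theorem sums the rest. *)
apply: (@le_trans _ _ (\sum_(T : {set E} | T \subset D)
   expR (q * t) * (x * expR (- q)) ^+ #|T|)).
  rewrite [leLHS]big_mkcond [leRHS]big_mkcond; apply: ler_sum => T _.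
  case: (T \subset D) => //=; case: ifP => [Tt|_]; last first.
    by rewrite mulr_ge0 ?exprn_ge0 ?mulr_ge0 ?expR_ge0.
  rewrite exprMn mulrCA ler_peMr ?exprn_ge0// -expRM_natl -expRD.
  rewrite -[leLHS]expR0 ler_expR.
  have : 0 <= q * (t - #|T|%:R) by rewrite mulr_ge0// subr_ge0.
  by congr (0 <= _); ring.
rewrite -mulr_sumr sum_expr_card expRD ler_wpM2l ?expR_ge0//.
rewrite [_ * #|D|%:R]mulrC expRM_natl lerXn2r ?nnegrE ?expR_ge0 ?expR_ge1Dx//.
by rewrite addr_ge0 ?mulr_ge0 ?expR_ge0.
Qed.
End GeneratingFunction.

(** * Iteration of the container step *)

Lemma powR_expR (R : realType) (a x : R) : 0 < a -> a `^ x = expR (x * ln a).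
Proof. by move=> a0; rewrite /powR gt_eqF. Qed.

(* The potential B - B' u^(-eta), with u = |D| / e0 and eta = (lambda - 1) / 2,
   decreases by more than the cost u^(1 - lambda) (log u + O(1)) of one container
   step each time |D| shrinks by the factor 1 - delta. *)
Lemma gen_fun_bound (R : realType) (delta lam sigma Y : R) :
  0 < delta -> delta <= 1 / 2 -> 1 < lam -> 0 < sigma -> 0 < Y ->
  exists2 B : R, 0 < B &
    forall (E : finType) (P : pred {set E}) (p e0 : R) (D0 : {set E}),
      0 < p -> 0 < e0 -> (forall I T : {set E}, P I -> T \subset I -> P T) ->
      (forall D : {set E}, D \subset D0 -> 2 * e0 < #|D|%:R ->
        has_containers (fun I => P I) D
          (sigma * (p * (e0 / #|D|%:R) `^ lam) * #|D|%:R) (delta * #|D|%:R)) ->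
      gen_fun P (Y * p) D0 <= expR (B * (p * e0)).
Proof.
move=> d0 d12 lam1 sigma0 Y0.
set eta := (lam - 1) / 2.
have eta0 : 0 < eta by rewrite divr_gt0// subr_gt0.
have d1 : 0 < 1 - delta by move: d12; lra.
(* [kap] is the relative growth of u^(-eta) when u shrinks by the factor 1 - delta; [c1] bounds the
   cost of one step in units of p * e0 * u^(-eta). With B' = c1 / kap the potential drop pays for
   the step. *)
pose kap := (1 - delta) `^ (- eta) - 1.
have kap0 : 0 < kap.
  rewrite subr_gt0 powR_expR// -[ltLHS]expR0 ltr_expR mulNr oppr_gt0.
  by rewrite pmulr_rlt0//; apply: ln_lt0; apply/andP; split=> //; rewrite gtrBl.
pose c1 := sigma * lam / eta + Y.
have c10 : 0 < c1 by rewrite addr_gt0// !mulr_gt0 ?invr_gt0// (lt_trans ltr01).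
pose B' := c1 / kap.
have B'0 : 0 < B' by rewrite divr_gt0.
exists (B' + 2 * Y) => [|E P p e0 D0 p0 e00 her cont].
  by rewrite addr_gt0// mulr_gt0.
pose pot (N : R) := p * e0 * (B' + 2 * Y - B' * (N / e0) `^ (- eta)).
have pe0 : 0 < p * e0 by rewrite mulr_gt0.
have pot_mono (M N : R) : 0 < M -> M <= N -> pot M <= pot N.
  move=> M0 MN; rewrite /pot ler_pM2l// lerD2l lerN2 ler_pM2l//.
  have N0 : 0 < N by exact: lt_le_trans MN.
  rewrite !powR_expR ?divr_gt0// ler_expR !mulNr lerN2 ler_pM2l//.
  by rewrite ler_ln ?posrE ?divr_gt0// ler_pM2r ?invr_gt0.
(* N >= e0 stands in for |D|, which may be so small that the potential turns negative. At N = e0 the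
   potential is 2 * Y * p * e0, the trivial bound for |D| <= 2 * e0. *)
suff main k (D : {set E}) (N : R) : (#|D| <= k)%N -> D \subset D0 ->
    e0 <= N -> #|D|%:R <= N -> gen_fun P (Y * p) D <= expR (pot N).
  pose N := Num.max e0 #|D0|%:R.
  apply: le_trans (main #|D0| D0 N _ _ _ _) _ => //; rewrite ?le_max ?lexx ?orbT//.
  rewrite ler_expR /pot mulrC ler_pM2r// gerBl mulr_ge0 ?powR_ge0// ltW//.
elim: k D N => [|k IH] D N Dk DD0 eN DN.
all: have [Dle|Dgt] := leP #|D|%:R (2 * e0).
1,3: apply: le_trans (gen_fun_le _ _ _) _; first by rewrite mulr_ge0// ltW.
1,2: rewrite ler_expR; apply: (@le_trans _ _ (p * e0 * (2 * Y))).
1,3: rewrite [leRHS](_ : _ = Y * p * (2 * e0)) ?ler_pM2l ?mulr_gt0//; ring.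
1,2: apply: le_trans (pot_mono _ _ e00 eN); rewrite /pot divff ?gt_eqF// powR1 mulr1.
1,2: by rewrite ler_pM2l// addrAC subrr add0r.
  by move: Dgt; rewrite leqn0 in Dk; rewrite (eqP Dk) ltNge mulr_ge0// ltW.
set M : R := #|D|%:R.
have M0 : 0 < M by apply: lt_trans Dgt; rewrite mulr_gt0.
apply: (@le_trans _ _ (expR (pot M))); last by rewrite ler_expR pot_mono.
set u := M / e0; set v := ln u.
have u0 : 0 < u by rewrite divr_gt0.
have u1 : 1 <= u by rewrite ler_pdivlMr// mul1r; move: Dgt; rewrite -/M; lra.
have v0 : 0 <= v by rewrite ln_ge0.
(* Since delta <= 1/2 and |D| > 2 * e0, the next size stays in the range of the induction. *)
have eM' : e0 <= (1 - delta) * M.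
  have : 1 / 2 * M <= (1 - delta) * M by rewrite ler_pM2r//; move: d12; lra.
  by move: Dgt; rewrite -/M; lra.
have lam0 : 0 < lam by apply: lt_trans lam1.
(* The tilt lam * ln u turns exp(-q) into (e0 / |D|)^lam, so x * exp(-q) * |D| has the order of the
   fingerprint size. *)
apply: le_trans (@gen_fun_step _ _ P (Y * p) D _ _ (lam * v) (expR (pot ((1 - delta) * M)))
  _ _ her (cont D DD0 Dgt) _ _) _.
- by rewrite mulr_ge0// ltW.
- by rewrite mulr_ge0// ltW.
- move=> D' D'D; rewrite -/M => hD'.
  have D'M : (#|D'|%:R : R) <= (1 - delta) * M by rewrite mulrBl mul1r.
  apply: IH => //; last exact: fintype.subset_trans DD0.
  rewrite -ltnS; apply: leq_trans Dk; rewrite -(ltr_nat R).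
  by apply: le_lt_trans D'M _; rewrite gtr_pMl// gtrBl.
- exact: expR_ge0.
rewrite -expRD ler_expR -/M.
set w := expR (- (eta * v)).
have w0 : 0 < w by apply: expR_gt0.
have w1 : w <= 1 by rewrite -expR0 ler_expR oppr_le0 mulr_ge0// ltW.
have uE : u = expR v by rewrite lnK// posrE.
have ulam : expR (- (lam * v)) * M = e0 * w ^+ 2.
  have -> : M = e0 * expR v by rewrite -uE /u mulrCA divff ?gt_eqF// mulr1.
  rewrite mulrCA -expRD expr2 -expRD; congr (_ * expR _).
  by rewrite /eta; field.
have elam : (e0 / M) `^ lam = expR (- (lam * v)).
  by rewrite powR_expR ?divr_gt0// -[e0 / M]invf_div lnV ?posrE// mulrN.
have potM' : ((1 - delta) * M / e0) `^ (- eta) = (kap + 1) * w.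
  by rewrite -mulrA powRM ?ltW// /kap subrK [u `^ _]powR_expR// mulNr.
have potM : (M / e0) `^ (- eta) = w by rewrite powR_expR// mulNr.
(* Half of the decay u^(1 - lam) absorbs the logarithm v. *)
have wv : w ^+ 2 * v <= w / eta.
  rewrite expr2 -mulrA ler_pM2l// -[leRHS]mul1r ler_pdivlMr// -mulrA [v * eta]mulrC.
  have -> : 1 = w * expR (eta * v) by rewrite /w -expRD addrC subrr expR0.
  by rewrite ler_pM2l//; apply: le_trans (expR_ge1Dx _); rewrite lerDr.
rewrite /pot potM potM' elam.
have -> : lam * v * (sigma * (p * expR (- (lam * v))) * M) + Y * p * expR (- (lam * v)) * M
   = p * e0 * (lam * sigma * (w ^+ 2 * v) + Y * w ^+ 2).
  transitivity ((lam * v * sigma * p + Y * p) * (expR (- (lam * v)) * M)); first by ring.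
  by rewrite ulam; ring.
rewrite -mulrDr ler_pM2l//.
have h1 : lam * sigma * (w ^+ 2 * v) <= lam * sigma * (w / eta).
  by rewrite ler_pM2l// mulr_gt0.
have h2 : Y * w ^+ 2 <= Y * w by rewrite ler_pM2l// expr2 ger_pMl.
have h3 : B' * ((kap + 1) * w) = B' * w + (lam * sigma * (w / eta) + Y * w).
  by rewrite /B' /c1; field; rewrite !gt_eqF.
by rewrite h3; move: h1 h2; lra.
Qed.
(** * Balanced supersaturation *)

Section Copies.
Context (V : finType) (H : graph V).
Implicit Types (W : finType).

Definition embeds W (D : {set {set W}}) (f : {ffun V -> W}) :=
  dinjectiveb f (mem (vertices H)) && [forall e in edges H, (f @: e)%SET \in D].

Definition contains W (D : {set {set W}}) := [exists f, embeds D f].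

(** A copy is kept as an edge set, so that it can be a hyperedge over the ground set of pairs; the
    injection still has to place the isolated vertices of H. *)
Definition is_copy W (A : {set {set W}}) :=
  [exists f : {ffun V -> W}, dinjectiveb f (mem (vertices H)) &&
     (A == [set (f @: (e : {set V}))%SET | e in edges H]%SET)].

Lemma edgeP (e : {set V}) : e \in edges H -> e \subset vertices H /\ #|e| = 2%N.
Proof.
by move=> /(fintype.subsetP (valP H)); rewrite inE => /andP[-> /eqP].
Qed.

Lemma imset_edge_inj W (f : V -> W) : {in vertices H &, injective f} ->
  {in edges H &, injective (fun e : {set V} => (f @: e)%SET)}.
Proof.
move=> fi e e' /edgeP[eV _] /edgeP[eV' _] ee'; apply/setP => x; apply/idP/idP => xe.
  have : f x \in (f @: e')%SET by rewrite -ee' imset_f.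
  by case/imsetP => y ye' /fi -> //; [exact: (fintype.subsetP eV)|exact: (fintype.subsetP eV')].
have : f x \in (f @: e)%SET by rewrite ee' imset_f.
by case/imsetP => y ye' /fi -> //; [exact: (fintype.subsetP eV')|exact: (fintype.subsetP eV)].
Qed.

Lemma containsP W (D : {set {set W}}) :
  reflect (exists2 A, is_copy A & A \subset D) (contains D).
Proof.
apply: (iffP existsP) => [[f /andP[fi /forall_inP fD]]|[A /existsP[f /andP[fi /eqP ->]] AD]].
  exists [set (f @: (e : {set V}))%SET | e in edges H]%SET.
    by apply/existsP; exists f; rewrite fi /=.
  by apply/fintype.subsetP => _ /imsetP[e eH ->]; apply: fD.
exists f; rewrite /embeds fi; apply/forall_inP => e eH.
by apply: (fintype.subsetP AD); apply: imset_f.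
Qed.

Lemma containsS W (D D' : {set {set W}}) : D \subset D' -> contains D -> contains D'.
Proof.
move=> DD' /containsP[A cA AD]; apply/containsP; exists A => //.
exact: fintype.subset_trans DD'.
Qed.

Lemma is_copy_card W (A : {set {set W}}) : is_copy A -> #|A| = ne H.
Proof.
case/existsP => f /andP[/dinjectiveP fi /eqP ->]; rewrite card_in_imset//.
exact: imset_edge_inj.
Qed.

Lemma has_copy_contains W (G : graph W) :
  vertices G = [set: W]%SET -> has_copy H G = contains (edges G).
Proof.
move=> GT; rewrite /has_copy /contains; apply: eq_existsb => f.
by rewrite /embeds GT finset.subsetT.
Qed.

End Copies.

Lemma span_graph_proof (W : finType) (D : {set {set W}}) :
  ([set: W]%SET, D :&: pairs [set: W]%SET).2
    \subset pairs ([set: W]%SET, D :&: pairs [set: W]%SET).1.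
Proof. exact: finset.subsetIr. Qed.

Definition span_graph (W : finType) (D : {set {set W}}) : graph W :=
  Graph (span_graph_proof D).

Lemma edges_span_graph (W : finType) (D : {set {set W}}) :
  D \subset pairs [set: W]%SET -> edges (span_graph D) = D.
Proof. by move=> DT; rewrite /edges/=; apply/finset.setIidPl. Qed.

(** Numbering the vertices of S pulls an H-free D back to an H-free graph on m vertices with equally
    many edges. *)
Lemma ex_num_contains (V : finType) (H : graph V) (m n : nat) (S : {set 'I_n})
    (D : {set {set 'I_n}}) :
  #|S| = m -> D \subset pairs S -> (ex_num m H < #|D|)%N -> contains H D.
Proof.
move=> Sm DS; apply: contraTT => nc; rewrite -leqNgt.
pose g (i : 'I_m) : 'I_n := enum_val (cast_ord (esym Sm) i).
have gi : injective g by move=> i j /enum_val_inj /cast_ord_inj.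
have gS x : x \in S -> exists i, g i = x.
  move=> xS; exists (cast_ord Sm (enum_rank_in xS x)).
  by rewrite /g cast_ordK enum_rankK_in.
pose D' := [set e : {set 'I_m} | (g @: e)%SET \in D]%SET.
have D'T : D' \subset pairs [set: 'I_m]%SET.
  apply/fintype.subsetP => e; rewrite !inE finset.subsetT /= => /(fintype.subsetP DS).
  by rewrite inE card_imset// => /andP[].
have DD' : D = [set (g @: (e : {set 'I_m}))%SET | e in D']%SET.
  apply/setP => e; apply/idP/imsetP => [eD|[e' + ->]]; last by rewrite inE.
  have ge : (g @: (g @^-1: e))%SET = e.
    apply/setP => x; apply/imsetP/idP => [[i + ->]|xe]; first by rewrite inE.
    have [|i gix] := gS x.
      have := fintype.subsetP DS _ eD; rewrite inE => /andP[/fintype.subsetP eS _].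
      exact: eS.
    by exists i; rewrite ?inE gix.
  by exists (g @^-1: e)%SET; rewrite ?inE ge.
have -> : #|D| = ne (span_graph D').
  by rewrite /ne edges_span_graph// DD' card_imset//; apply: imset_inj.
rewrite /ex_num; apply: (@leq_bigmax_cond _ _ (@ne _) (span_graph D')).
rewrite /Defs.free has_copy_contains// eqxx/= edges_span_graph//.
apply: contraNN nc => /existsP[f /andP[/dinjectiveP fi /forall_inP fD]].
apply/existsP; exists [ffun x => g (f x)]; apply/andP; split.
  apply/dinjectiveP => x y xH yH; rewrite !ffunE => /gi; exact: fi.
apply/forall_inP => e eH; have := fD e eH; rewrite inE -imset_comp.
by congr (_ \in D); apply: eq_imset => x; rewrite ffunE.
Qed.

Lemma le_m2 (R : realType) (V : finType) (H F : graph V) :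
  subgraph F H -> (2 < nv F)%N ->
  (ne F)%:R - 1 <= m2 R H * ((nv F)%:R - 2).
Proof.
move=> FH F2; rewrite -ler_pdivrMr; last by rewrite subr_gt0 ltr_nat.
by apply: (@bigmax_sup _ _ _ _ F); rewrite ?FH.
Qed.

(** Three consecutive vertices of a cycle carry a path with two edges, whose ratio is 1. *)
Lemma m2_ge1 (R : realType) (V : finType) (H : graph V) : has_cycle H -> 1 <= m2 R H.
Proof.
case=> -[|x [|y [|z s]]] [//= _ /andP[/and3P[xy yz _] /and4P[]]].
rewrite !inE !negb_or => /and3P[nxy nxz _] /andP[nyz _] _ _.
pose X := [set x; y; z]%SET; pose Y := [set [set x; y]; [set y; z]]%SET.
have xyz : #|X| = 3%N.
  by rewrite /X finset.setUC cardsU1 cards2 !inE negb_or nxy eq_sym nxz eq_sym nyz.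
have cY : #|Y| = 2%N.
  rewrite /Y cards2; case: eqP => // /setP/(_ x); rewrite !inE eqxx (negbTE nxy).
  by rewrite (negbTE nxz).
have YX : (X, Y).2 \subset pairs (X, Y).1.
  apply/fintype.subsetP => e /=; rewrite !inE => /orP[] /eqP ->;
  rewrite cards2 ?nxy ?nyz andbT; apply/fintype.subsetP => t; rewrite !inE.
    by case/orP => ->; rewrite ?orbT.
  by case/orP => ->; rewrite ?orbT.
have := @le_m2 R V H (Graph YX); rewrite /nv /ne /= xyz cY.
have -> : (3 : R) - 2 = 1 by ring.
have -> : (2 : R) - 1 = 1 by ring.
rewrite mulr1; apply=> //; apply/andP; split; apply/fintype.subsetP => t; rewrite !inE.
  have [xyH _] := edgeP xy; have [yzH _] := edgeP yz.
  case/orP => [/orP[]|] /eqP ->; [apply: (fintype.subsetP xyH)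
    |apply: (fintype.subsetP xyH)|apply: (fintype.subsetP yzH)];
  by rewrite !inE eqxx ?orbT.
by case/orP => /eqP ->.
Qed.

(** S pulls back along the embedding to a subgraph of H with |S| edges and |cover S| vertices. A
    single edge is treated apart, as [m2] ranges over more than two vertices; both sides then
    vanish. *)
Lemma copy_density (R : realType) (V : finType) (H : graph V) (W : finType)
    (A S : {set {set W}}) :
  is_copy H A -> S \subset A -> S != finset.set0 ->
  (2 <= #|finset.cover S|)%N /\ (#|S|.-1)%:R <= m2 R H * (#|finset.cover S| - 2)%:R.
Proof.
move=> /existsP[f /andP[/dinjectiveP fi /eqP ->]] SA S0.
have Se s : s \in S -> exists2 e, e \in edges H & s = (f @: e)%SET.
  by move/(fintype.subsetP SA)/imsetP => [e eH ->]; exists e.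
have ce s : s \in S -> #|s| = 2%N.
  move=> /Se[e eH ->]; have [eV <-] := edgeP eH; apply: card_in_imset => x y xe ye.
  by apply: fi; apply: (fintype.subsetP eV).
have S2 : (2 <= #|finset.cover S|)%N.
  case/set0Pn: S0 => s sS; rewrite -(ce s sS); apply: subset_leq_card.
  by rewrite /finset.cover; apply: (finset.bigcup_sup s).
split=> //.
have [S3|S3] := ltnP 2 #|finset.cover S|; last first.
  have -> : #|S|.-1 = 0%N; last by rewrite (eqP (_ : (#|finset.cover S| - 2)%N == 0%N)) ?subn_eq0// mulr0.
  apply/eqP; rewrite -subn1 subn_eq0.
  apply: (@leq_trans #|[set finset.cover S]%SET|); last by rewrite cards1.
  apply: subset_leq_card; apply/fintype.subsetP => s sS; rewrite inE.
  rewrite eqEcard (ce s sS) S3 andbT; exact: (finset.bigcup_sup s).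
pose X := [set x in vertices H | f x \in finset.cover S]%SET.
pose Y := [set e in edges H | (f @: (e : {set V}))%SET \in S]%SET.
have YX : (X, Y).2 \subset pairs (X, Y).1.
  apply/fintype.subsetP => e /=; rewrite !inE => /andP[/edgeP[eV ->] eS].
  rewrite eqxx andbT; apply/fintype.subsetP => x xe; rewrite inE (fintype.subsetP eV)//=.
  by apply/finset.bigcupP; exists (f @: e)%SET => //; apply: imset_f.
have cY : #|Y| = #|S|.
  rewrite -(@card_in_imset _ _ (fun e : {set V} => f @: e)%SET Y); last first.
    move=> e e'; rewrite !inE => /andP[eH _] /andP[eH' _]; exact: (imset_edge_inj fi).
  apply: eq_card => s; apply/imsetP/idP => [[e]|sS]; first by rewrite inE => /andP[_ ?] ->.
  by have [e eH se] := Se s sS; exists e; rewrite // inE eH -se.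
have cX : #|X| = #|finset.cover S|.
  rewrite -(@card_in_imset _ _ f X); last first.
    by move=> x y; rewrite !inE => /andP[xH _] /andP[yH _]; apply: fi.
  apply: eq_card => v; apply/imsetP/idP => [[x]|]; first by rewrite inE => /andP[_ ?] ->.
  case/finset.bigcupP => s sS vs; have [e eH se] := Se s sS.
  move: vs; rewrite se => /imsetP[x xe vx]; exists x => //; rewrite inE -vx.
  have [eV _] := edgeP eH; rewrite (fintype.subsetP eV)//=.
  by apply/finset.bigcupP; exists s => //; rewrite se vx imset_f.
have := @le_m2 R V H (Graph YX); rewrite /nv /ne /= cX cY natrB// -subn1 natrB ?card_gt0//.
apply=> //; apply/andP; split; apply/fintype.subsetP => t; rewrite inE => /andP[] //.
Qed.

(** * Packings and counts of supersets *)

(** Greedy choice: while more than a elements are left, take a member of C among them and remove its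
    l elements. *)
Lemma packing (E : finType) (C : pred {set E}) (l a : nat) (D : {set E}) :
  (0 < l)%N -> (forall A, C A -> #|A| = l) ->
  (forall D' : {set E}, D' \subset D -> (a < #|D'|)%N ->
     exists2 A : {set E}, C A & A \subset D') ->
  exists P : {set {set E}}, [/\ finset.trivIset P,
    forall A, A \in P -> C A /\ A \subset D & (#|D| <= a + l * #|P|)%N].
Proof.
move=> l0 Cl; have [k] := ubnP #|D|; elim: k D => // k IH D Dk Cex.
have [Da|Da] := leqP #|D| a.
  exists finset.set0; split => [|A|]; rewrite ?inE ?cards0 ?muln0 ?addn0//.
  by apply/finset.trivIsetP => A B; rewrite inE.
have [A CA AD] := Cex D (fintype.subxx D) Da.
have A0 : (0 < #|A|)%N by rewrite Cl.
have [||P [tP PC Pc]] := IH (D :\: A).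
- rewrite -ltnS; apply: leq_trans Dk; rewrite ltnS cardsDS//.
  by rewrite ltn_subrL A0 (leq_trans A0 (subset_leq_card AD)).
- move=> D' D'D; apply: Cex; apply: fintype.subset_trans D'D _.
  exact: finset.subsetDl.
have dis B : B \in P -> [disjoint A & B].
  by case/PC => _; rewrite finset.subsetD => /andP[_]; rewrite disjoint_sym.
have [|tAP nAP] := trivIsetU1 dis tP.
  by apply/negP => /PC[/Cl]; rewrite cards0 => l00; rewrite -l00 in l0.
exists (A |: P)%SET; split => //; first move=> B.
  rewrite in_setU1 => /orP[/eqP ->//|/PC[CB BD]]; split=> //.
  exact: fintype.subset_trans BD (finset.subsetDl _ _).
rewrite cardsU1 nAP mulnDr muln1 addnCA -(Cl A CA).
by rewrite -leq_subLR -(cardsDS AD) (Cl A CA).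
Qed.

Lemma card_supersets (T : finType) (B : {set T}) (m : nat) :
  #|[set S : {set T} | (B \subset S) && (#|S| == m)]%SET| =
  if (#|B| <= m)%N then 'C(#|T| - #|B|, m - #|B|) else 0%N.
Proof.
case: ifP => Bm; last first.
  apply/eqP; rewrite cards_eq0; apply/eqP/setP => S; rewrite !inE.
  apply/negP => /andP[BS /eqP Sm]; move/negP: Bm; apply.
  by rewrite -Sm subset_leq_card.
have -> : (#|T| - #|B|)%N = #|(~: B)%SET| by rewrite [RHS]cardsCs finset.setCK.
rewrite -cards_draws.
rewrite -[RHS](@card_in_imset _ _ (fun S' => B :|: S')%SET); last first.
  move=> S S'; rewrite !inE => /andP[SB _] /andP[SB' _] eS; apply/setP => x.
  have := congr1 (fun X : {set T} => x \in X) eS; rewrite !inE.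
  have [xB _|//] := boolP (x \in B).
  have nB (X : {set T}) : X \subset ~: B -> (x \in X) = false.
    by move=> XB; apply/negP => /(fintype.subsetP XB); rewrite inE xB.
  by rewrite (nB S SB) (nB S' SB').
apply: eq_card => S; rewrite inE; apply/andP/imsetP => [[BS /eqP Sm]|[S' + ->]].
  exists (S :\: B); first by rewrite inE cardsDS// Sm eqxx andbT finset.setDE finset.subsetIr.
  by rewrite finset.setDE finset.setUIr finset.setUCr finset.setIT; apply/esym/finset.setUidPr.
rewrite inE => /andP[SB /eqP Sm]; rewrite finset.subsetUl; split=> //.
rewrite cardsU; have /eqP -> : (B :&: S')%SET == finset.set0.
  by rewrite setI_eq0 disjoint_sym finset.disjoints_subset.
by rewrite cards0 subn0 Sm subnKC.
Qed.

(** The ratio of the binomials is the product of (m' - i) / (n' - i) over i < k, and each factor is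
    at most m / n because m' / n' is and m <= n. *)
Lemma bin_ratio (n' m' n m k : nat) : (k <= m')%N -> (m' <= n')%N -> (m <= n)%N ->
  (m' * n <= m * n')%N ->
  ('C(n' - k, m' - k) * n ^ k <= 'C(n', m') * m ^ k)%N.
Proof.
move=> km mn' mn h; elim: k km => [|k IH] km; first by rewrite !subn0 !expn0 !muln1.
apply: leq_trans (_ : 'C(n' - k, m' - k) * n ^ k * m <= _)%N; last first.
  by rewrite expnSr mulnA leq_mul2r IH ?orbT// ltnW.
have kn : (0 < n' - k)%N by rewrite subn_gt0 (leq_trans km).
rewrite -(leq_pmul2r kn).
have e := mul_bin_diag (n' - k) (m' - k.+1).
rewrite -subnS (subnSK km) in e.
have -> : ('C(n' - k.+1, m' - k.+1) * n ^ k.+1 * (n' - k) =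
   (n' - k) * 'C(n' - k.+1, m' - k.+1) * (n ^ k * n))%N.
  by rewrite expnSr; ring.
have hh : ((m' - k) * n <= m * (n' - k))%N.
  by rewrite mulnBl mulnBr leq_sub// mulnC leq_mul2l mn orbT.
rewrite e; set x := 'C(_, _).
have -> : ((m' - k) * x * (n ^ k * n) = x * n ^ k * ((m' - k) * n))%N by ring.
by rewrite -[leqRHS]mulnA leq_mul2l hh orbT.
Qed.

(** * Supersaturation by sampling vertex sets *)

Section Supersaturation.
Context (R : realType) (V : finType) (H : graph V) (n m : nat).
Context (D : {set {set 'I_n}}).
Hypotheses (H0 : (0 < ne H)%N) (DT : D \subset pairs [set: 'I_n]%SET).
Hypotheses (D0 : (0 < #|D|)%N) (m_ge2 : (2 <= m)%N) (mn : (m <= n)%N).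
Hypothesis D_dense : (4 * ex_num m H * n ^ 2 <= #|D| * m ^ 2)%N.

Let C2 := 'C(n - 2, m - 2).

Lemma sum_supersets (D' : {set {set 'I_n}}) : D' \subset pairs [set: 'I_n]%SET ->
  (\sum_(S : {set 'I_n} | #|S| == m) #|[set e in D' | e \subset S]%SET| = #|D'| * C2)%N.
Proof.
move=> DT'.
under eq_bigr do rewrite -sum1_card.
rewrite (exchange_big_dep (mem D'))/=; last by move=> S e _; rewrite inE => /andP[].
rewrite -sum_nat_const; apply: eq_bigr => e eD.
have e2 : #|e| = 2%N by have := fintype.subsetP DT' _ eD; rewrite inE => /andP[_ /eqP].
have := @card_supersets _ e m; rewrite card_ord e2 m_ge2 -/C2 => <-.
rewrite -sum1_card; apply: eq_bigl => S; rewrite !inE; have -> : e \in D' by [].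
by rewrite andbC.
Qed.

(** By [D_dense] an m-set spans on average at least 2 * ex(m, H) edges of D, so the excess over
    ex(m, H), for which the families P account, is at least half of the total. *)
Lemma sum_excess (P : {set 'I_n} -> {set {set {set 'I_n}}}) :
  (forall S : {set 'I_n}, #|S| = m ->
     (#|[set e in D | e \subset S]%SET| <= ex_num m H + ne H * #|P S|)%N) ->
  (#|D| * C2 <= 2 * (ne H * \sum_(S : {set 'I_n} | #|S| == m) #|P S|))%N.
Proof.
have := D_dense; set a := ex_num m H => dense hP.
have h1 : (#|D| * C2 <= a * 'C(n, m) +
    ne H * \sum_(S : {set 'I_n} | #|S| == m) #|P S|)%N.
  rewrite -sum_supersets//.
  apply: (@leq_trans (\sum_(S : {set 'I_n} | #|S| == m) (a + ne H * #|P S|))).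
    by apply: leq_sum => S /eqP; exact: hP.
  rewrite big_split/= -big_distrr/= sum_nat_const leq_add2r mulnC leq_mul2l.
  have := card_draws 'I_n m; rewrite card_ord => <-.
  by rewrite leq_eqVlt (eq_card (B := [set A : {set 'I_n} | #|A| == m]%SET)) ?eqxx ?orbT// => S; rewrite inE.
suff h2 : (2 * (a * 'C(n, m)) <= #|D| * C2)%N by lia.
have e : (n * (n - 1) * C2 = m * (m - 1) * 'C(n, m))%N.
  have e1 := mul_bin_diag n (m - 1); have e2 := mul_bin_diag (n - 1) (m - 2).
  have mm1 : ((m - 1).+1 = m)%N by lia.
  have mm2 : ((m - 2).+1 = m - 1)%N by lia.
  have nn1 : (n.-1 = n - 1)%N by lia.
  have nn2 : ((n - 1).-1 = n - 2)%N by lia.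
  rewrite mm1 nn1 in e1; rewrite mm2 nn2 -/C2 in e2.
  by rewrite -mulnA e2 mulnCA e1; ring.
have mm0 : (0 < m * (m - 1))%N by rewrite muln_gt0; lia.
rewrite -(leq_pmul2l mm0).
have -> : (m * (m - 1) * (2 * (a * 'C(n, m))) = 2 * a * (n * (n - 1)) * C2)%N.
  by rewrite -[RHS]mulnA e; ring.
rewrite [leqRHS]mulnA leq_mul2r; apply/orP; right.
(* The 4 in [D_dense] is a 2 for the excess times a 2 for passing from m^2 to m * (m - 1). *)
have hm : (m ^ 2 <= 2 * (m * (m - 1)))%N.
  by case: m m_ge2 => [//|[//|k]] _; rewrite subn1/=; nia.
have hn : (n * (n - 1) <= n ^ 2)%N by rewrite leq_mul2l leq_subr orbT.
nia.
Qed.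

Lemma trivIset_superset (E : finType) (P : {set {set E}}) (T : {set E}) :
  finset.trivIset P -> T != finset.set0 ->
  \sum_(A : {set E} | T \subset A) (A \in P)%:R
    = [exists A in P, T \subset A]%:R :> R.
Proof.
move=> /finset.trivIsetP tP /set0Pn[t tT].
have [/exists_inP[A0 A0P TA0]|nE] := boolP [exists A in P, T \subset A]; last first.
  rewrite big1// => A TA; case: (boolP (A \in P)) => // AP.
  by case/negP: nE; apply/exists_inP; exists A.
rewrite (bigD1 A0)//= A0P big1 ?addr0// => A /andP[TA AA0].
case: (boolP (A \in P)) => // AP; have := tP _ _ AP A0P AA0.
rewrite -setI_eq0 => /eqP/setP/(_ t).
by rewrite !inE (fintype.subsetP TA)// (fintype.subsetP TA0).
Qed.

(** With k = |B| - 2 the count is at most C2 * (m / n)^k <= C2 * tau^(m_2(H) * k), and j <= m_2(H) *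
    k with tau <= 1 leaves tau^j. *)
Lemma superset_ratio (B : {set 'I_n}) (tau : R) (j : nat) :
  0 < tau -> tau <= 1 -> m%:R / n%:R <= tau `^ Defs.m2 R H ->
  (2 <= #|B|)%N -> j%:R <= Defs.m2 R H * (#|B| - 2)%:R ->
  #|[set S : {set 'I_n} | (B \subset S) && (#|S| == m)]%SET|%:R <= C2%:R * tau ^+ j.
Proof.
move=> tau0 tau1 hmn B2 hj; rewrite card_supersets card_ord.
case: ifP => Bm; last by rewrite mulr_ge0// exprn_ge0// ltW.
have n0 : (0 < n%:R :> R) by rewrite ltr0n (leq_trans _ mn)// (leq_trans _ m_ge2).
set k := (#|B| - 2)%N in hj.
have -> : 'C(n - #|B|, m - #|B|) = 'C(n - 2 - k, m - 2 - k).
  by rewrite -!subnDA /k subnKC.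
apply: (@le_trans _ _ (C2%:R * (m%:R / n%:R) ^+ k)).
  rewrite expr_div_n mulrA ler_pdivlMr ?exprn_gt0// -!natrX -!natrM ler_nat.
  apply: bin_ratio => //; rewrite ?leq_sub2r//.
  by rewrite mulnBl mulnBr leq_sub2l// mulnC leq_mul2l mn orbT.
rewrite ler_wpM2l//; apply: (@le_trans _ _ ((tau `^ Defs.m2 R H) ^+ k)).
  by rewrite lerXn2r// ?nnegrE ?divr_ge0 ?powR_ge0.
rewrite -powR_mulrn ?powR_ge0// -powRrM -powR_mulrn ?(ltW tau0)//.
rewrite !powR_expR// ler_expR ler_wnM2r//.
by rewrite ln_le0.
Qed.

Lemma supersaturation (tau : R) :
  0 < tau -> tau <= 1 -> m%:R / n%:R <= tau `^ Defs.m2 R H ->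
  exists (G : {set {set 'I_n}} -> R) (W : R),
    [/\ 0 < W, forall A, 0 <= G A, uniform_on G D (ne H), W <= \sum_A G A
      & spread (2 * (ne H)%:R) W tau #|D|%:R G] /\
    (forall I : {set {set 'I_n}}, ~~ contains H I -> independent G I).
Proof.
move=> tau0 tau1 hmn.
have /boolp.choice[P HP] : forall S : {set 'I_n}, exists P : {set {set {set 'I_n}}},
    #|S| = m -> [/\ finset.trivIset P,
      forall A, A \in P -> is_copy H A /\ A \subset [set e in D | e \subset S]%SET
      & (#|[set e in D | e \subset S]%SET| <= ex_num m H + ne H * #|P|)%N].
  move=> S; have [Sm|nSm] := eqVneq #|S| m; last by exists finset.set0 => Sm; rewrite Sm eqxx in nSm.
  have [||P HP] := @packing _ (@is_copy _ H 'I_n) (ne H) (ex_num m H)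
      [set e in D | e \subset S]%SET H0.
  - exact: is_copy_card.
  - move=> D' D'S aD'; have D'p : D' \subset pairs S.
      apply/fintype.subsetP => e /(fintype.subsetP D'S); rewrite !inE => /andP[eD ->].
      by have := fintype.subsetP DT _ eD; rewrite inE => /andP[].
    by have /containsP[A cA AD'] := ex_num_contains Sm D'p aD'; exists A.
  - by exists P.
pose G (A : {set {set 'I_n}}) : R := \sum_(S : {set 'I_n} | #|S| == m) (A \in P S)%:R.
have GP A : G A != 0 -> exists2 S : {set 'I_n}, #|S| = m & A \in P S.
  move=> GA; apply: contraPP GA => nP; apply/negP/negPn/eqP.
  rewrite /G big1// => S /eqP Sm; case: (boolP (A \in P S)) => // AP.
  by case: nP; exists S.
have l0 : 0 < (ne H)%:R :> R by rewrite ltr0n.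
have C20 : (0 < C2)%N by rewrite bin_gt0 leq_sub2r.
(* W is the lower bound on the total weight given by [sum_excess]; with K = 2 * ne H the quotient K
   * W / |D| is exactly C2. *)
exists G, (#|D|%:R * C2%:R / (2 * (ne H)%:R)); split; first split.
- by rewrite divr_gt0 ?mulr_gt0 ?ltr0n.
- by move=> A; apply: sumr_ge0.
- move=> A /GP[S Sm AP]; have [_ /(_ A AP)[cA AD] _] := HP S Sm.
  rewrite (is_copy_card cA); split => //; apply: fintype.subset_trans AD _.
  by apply/fintype.subsetP => e; rewrite inE => /andP[].
- rewrite ler_pdivrMr ?mulr_gt0// -natrM.
  have -> : \sum_A G A = (\sum_(S : {set 'I_n} | #|S| == m) #|P S|)%:R.
    rewrite /G exchange_big natr_sum/=; apply: eq_bigr => S _.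
    by rewrite -sum1_card natr_sum [RHS]big_mkcond/=; apply: eq_bigr => A _; case: (A \in P S).
  have hs : (#|D| * C2 <= 2 * (ne H * \sum_(S : {set 'I_n} | #|S| == m) #|P S|))%N.
    by apply: sum_excess => S Sm; have [] := HP S Sm.
  by rewrite -!natrM ler_nat; apply: leq_trans hs _; rewrite mulnA mulnC leqnn.
- move=> T T0.
  have cancel (l d c t : R) : 0 < l -> 0 < d -> 2 * l * (d * c / (2 * l)) * t / d = c * t.
    by move=> l_gt0 d_gt0; field; rewrite !gt_eqF.
  rewrite cancel ?ltr0n//.
  have [[A TA GA]|nA] := pselect (exists2 A : {set {set 'I_n}}, T \subset A & G A != 0); last first.
    rewrite /wdeg big1 ?mulr_ge0 ?exprn_ge0 ?(ltW tau0)// => A TA.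
    by apply/eqP/negPn/negP => GA; apply: nA; exists A.
  have [S0 S0m AP] := GP A GA; have [_ /(_ A AP)[cA _] _] := HP S0 S0m.
  have [c2 cm] := copy_density R cA TA T0.
  apply: le_trans (superset_ratio tau0 tau1 hmn c2 cm).
  (* The copies packed in one m-set are edge-disjoint, so this m-set adds at most 1 to the degree of
     T, and only if it contains every vertex of T. *)
  rewrite /wdeg /G exchange_big/= -sum1_card natr_sum [leLHS]big_mkcond [leRHS]big_mkcond/=.
  apply: ler_sum => S _; rewrite inE; case: ifP => [/eqP Sm|_]; last by rewrite andbF.
  have [tP PS _] := HP S Sm; rewrite trivIset_superset// andbT.
  have [/exists_inP[B BP TB]|_] := boolP [exists B in P S, T \subset B]; last by case: ifP.
  rewrite ifT//; apply/finset.bigcupsP => e eT.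
  by have [_ /fintype.subsetP/(_ e)] := PS B BP; rewrite inE (fintype.subsetP TB)// => /(_ isT)/andP[].
- move=> I nI A /GP[S Sm AP]; have [_ /(_ A AP)[cA _] _] := HP S Sm.
  by apply: contraNN nI => AI; apply/containsP; exists A.
Qed.

End Supersaturation.

(** * Containers for edge sets without a copy of H *)

Lemma card_pairs (W : finType) (X : {set W}) : (#|pairs X| <= #|X| ^ 2)%N.
Proof.
rewrite cards_draws; move: #|X| => n.
rewrite bin2; apply: (@leq_trans (n * n.-1)); first by lia.
by rewrite leq_mul2l leq_pred orbT.
Qed.

Section GraphContainers.
Context (R : realType) (V : finType) (H : graph V) (al A : R).
Hypotheses (H0 : (0 < ne H)%N) (mu1 : 1 <= m2 R H) (al0 : 0 < al) (al2 : al < 2).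
Hypotheses (A1 : 1 <= A).
Hypothesis exA : forall n : nat, (ex_num n H)%:R <= A * n%:R `^ al.
Hypothesis lam1 : 1 < lambda al H.

Let lam := lambda al H.
(** 4 * A comes from the density condition of supersaturation, and 3 from rounding the sample size
    to an integer. *)
Let B0 := 4 * A * 3 `^ (2 - al).

Let mu0 : 0 < m2 R H. Proof. exact: lt_le_trans mu1. Qed.
Let A0 : 0 < A. Proof. exact: lt_le_trans A1. Qed.
Let B00 : 0 < B0. Proof. by rewrite !mulr_gt0// powR_gt0. Qed.
Let be0 : 0 < 2 - al. Proof. by rewrite subr_gt0. Qed.

(** Samples of size m of order (n^2 / |D|)^(1 / (2 - al)) are dense enough for supersaturation, and
    then (m / n)^(1 / m_2(H)) has order (n^al / |D|)^lam: this is the source of the exponent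
    lambda. *)
Lemma graph_containers : exists2 delta : R, 0 < delta <= 1 / 2 &
  forall (n : nat) (D : {set {set 'I_n}}), (0 < n)%N ->
    D \subset pairs [set: 'I_n]%SET -> B0 * n%:R `^ al <= #|D|%:R ->
    has_containers (fun I : {set {set 'I_n}} => ~~ contains H I) D
      (2 * (ne H)%:R * (B0 * n%:R `^ al / #|D|%:R) `^ lam * #|D|%:R)
      (delta * #|D|%:R).
Proof.
have K1 : 1 <= 2 * (ne H)%:R :> R.
  by rewrite -natrM ler1n muln_gt0.
have [d d0 Hd] := hypergraph_container (ne H) K1.
exists (Num.min d (1 / 2)); first by rewrite lt_min d0 ge_min lexx orbT divr_gt0.
move=> n D n0 DT DB; set N : R := #|D|%:R in DB *.
have nR0 : 0 < n%:R :> R by rewrite ltr0n.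
have Bn0 : 0 < B0 * n%:R `^ al by rewrite mulr_gt0 ?powR_gt0.
have N0 : 0 < N by apply: lt_le_trans DB.
have Nn : N <= n%:R ^+ 2.
  rewrite -natrX ler_nat; apply: leq_trans (subset_leq_card DT) _.
  by have := card_pairs [set: 'I_n]%SET; rewrite cardsT card_ord.
set rho := B0 * n%:R `^ al / N.
have rho0 : 0 < rho by rewrite divr_gt0.
have rho1 : rho <= 1 by rewrite ler_pdivrMr// mul1r.
set tau := rho `^ lam.
have lam0 : 0 < lam by apply: lt_trans lam1.
have tau0 : 0 < tau by rewrite powR_gt0.
have tau1 : tau <= 1.
  by rewrite /tau powR_expR// -[leRHS]expR0 ler_expR pmulr_rle0// ln_le0.
have lammu : lam * m2 R H = (2 - al)^-1.
  by rewrite /lam /lambda; field; rewrite !gt_eqF.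
have [y yE] : exists y : R, y = 4 * A * n%:R ^+ 2 / N by eexists.
have y0 : 0 < y by rewrite yE divr_gt0// !mulr_gt0// exprn_gt0.
have y1 : 1 <= y.
  rewrite yE ler_pdivlMr// mul1r (le_trans Nn)// ler_peMl// ?exprn_ge0//; move: A1; lra.
(* x solves 4 * A * x^al * n^2 = |D| * x^2: at this real sample size the density condition is
   tight. *)
pose x := y `^ (2 - al)^-1.
have x0 : 0 < x by rewrite powR_gt0.
have x1 : 1 <= x.
  by rewrite /x powR_expR// -[leLHS]expR0 ler_expR mulr_ge0 ?invr_ge0 ?(ltW be0)// ln_ge0.
have nal : n%:R `^ al = n%:R ^+ 2 * n%:R `^ (al - 2) :> R.
  rewrite -powR_mulrn// -powRD; last by apply/implyP => _; rewrite gt_eqF.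
  by congr (_ `^ _); ring.
have x3 : 3 * x / n%:R = tau `^ m2 R H.
  rewrite /tau -powRrM lammu.
  have -> : rho = 3 `^ (2 - al) * y * n%:R `^ (al - 2).
    rewrite /rho yE /B0.
    by rewrite nal; field; rewrite gt_eqF.
  rewrite !powRM ?mulr_ge0 ?powR_ge0 ?(ltW y0)// -!powRrM divff ?gt_eqF// powRr1//.
  congr (_ * _); rewrite -opprB mulNr divff ?gt_eqF//.
  by rewrite powR_inv1.
(* Adding 2 to the integer part ensures m >= 2 and m >= x, while x >= 1 gives m <= 3 * x. *)
pose m := (Num.truncn x).+2.
have xm : x <= m%:R.
  by rewrite /m ltW// (lt_le_trans (truncnS_gt _))// ler_nat.
have mx : m%:R <= 3 * x.
  have : (Num.truncn x)%:R <= x by rewrite truncn_le ltW.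
  by rewrite /m -!natr1; move: x1; lra.
have mR0 : 0 < m%:R :> R by rewrite ltr0n.
have hm : m%:R / n%:R <= tau `^ m2 R H by rewrite -x3 ler_pM2r// invr_gt0.
have mn : (m <= n)%N.
  rewrite -(ler_nat R) -[leRHS]mul1r -ler_pdivrMr//; apply: le_trans hm _.
  by rewrite powR_expR// -[leRHS]expR0 ler_expR pmulr_rle0// ln_le0.
have D_dense : (4 * ex_num m H * n ^ 2 <= #|D| * m ^ 2)%N.
  rewrite -(ler_nat R) natrM [leRHS]natrM !natrX natrM -/N.
  apply: (@le_trans _ _ (4 * (A * m%:R `^ al) * n%:R ^+ 2)).
    by rewrite ler_pM2r ?exprn_gt0// ler_pM2l.
  have -> : 4 * (A * m%:R `^ al) * n%:R ^+ 2 = N * (y * m%:R `^ al).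
    by rewrite yE; field; rewrite gt_eqF.
  rewrite ler_pM2l//; have -> : m%:R ^+ 2 = m%:R `^ (2 - al) * m%:R `^ al :> R.
    rewrite -powRD; last by apply/implyP => _; rewrite gt_eqF.
    by rewrite subrK powR_mulrn// ltW.
  rewrite ler_pM2r ?powR_gt0//.
  have -> : y = x `^ (2 - al) by rewrite -powRrM mulVf ?gt_eqF// powRr1// ltW.
  by rewrite ge0_ler_powR// ?nnegrE// ltW.
(* This absorbs the + 1 in the fingerprint size. It rests on |D| <= n^2 and lam * (2 - al) = 1 /
   m_2(H) <= 1. *)
have tN1 : 1 <= tau * N.
  have -> : tau * N = B0 * n%:R `^ al * rho `^ (lam - 1).
    have -> : tau = rho `^ (lam - 1) * rho.
      rewrite -[X in _ * X](powRr1 (ltW rho0)) -powRD ?subrK//.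
      by apply/implyP => _; rewrite gt_eqF.
    by rewrite -mulrA [RHS]mulrC /rho divfK ?gt_eqF.
  have n1 : 1 <= n%:R :> R by rewrite ler1n.
  have B1 : 1 <= B0.
    have : 1 <= 3 `^ (2 - al) :> R.
      by rewrite powR_expR// -[leLHS]expR0 ler_expR mulr_ge0 ?(ltW be0)// ln_ge0// ler1n.
    by rewrite /B0; move: A1; set t := 3 `^ _; nra.
  apply: (@le_trans _ _ (n%:R `^ al * (n%:R `^ (al - 2)) `^ (lam - 1))).
    rewrite -powRrM -powRD; last by apply/implyP => _; rewrite gt_eqF.
    rewrite powR_expR// -[leLHS]expR0 ler_expR mulr_ge0 ?ln_ge0//.
    have -> : al + (al - 2) * (lam - 1) = 2 - lam * (2 - al) by ring.
    have -> : lam * (2 - al) = (m2 R H)^-1.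
      by rewrite /lam /lambda; field; rewrite !gt_eqF.
    by have : (m2 R H)^-1 <= 1 by [rewrite invf_le1]; lra.
  rewrite ler_pM ?powR_ge0//; first by rewrite ler_peMl// powR_ge0.
  rewrite ge0_ler_powR ?nnegrE ?powR_ge0 ?(ltW rho0) ?subr_ge0 ?(ltW lam1)//.
  rewrite /rho ler_pdivlMr//; apply: (@le_trans _ _ (n%:R `^ (al - 2) * n%:R ^+ 2)).
    by rewrite ler_pM2l// powR_gt0.
  by rewrite mulrC -nal ler_peMl// powR_ge0.
have D0 : (0 < #|D|)%N by rewrite -(ltr_nat R).
have [G [W [[W0 G0 Gs GW Gsp] Gind]]] :=
  supersaturation H0 DT D0 (isT : (2 <= m)%N) mn D_dense tau0 tau1 hm.
have [Rm HRm] := Hd _ D G W tau N W0 tau0 N0 (lexx _) G0 Gs GW Gsp.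
exists Rm => I /Gind /HRm[T [TI Tc TX]]; exists T; split=> //.
  apply: le_trans Tc _; rewrite -/tau -mulrA [2 * _]mulrC -mulrA ler_wpM2l//.
  by move: tN1; lra.
move=> X h1 h2; have [k1 k2 k3] := TX X h1 h2; split=> //.
by apply: le_trans k2; rewrite ler_pM2r// ge_min lexx.
Qed.

Lemma contains_gen_fun : exists2 B : R, 0 < B &
  forall (n : nat) (p : R), (0 < n)%N -> 0 < p -> p <= 1 ->
    gen_fun (fun I : {set {set 'I_n}} => ~~ contains H I) (expR 1 * p)
      (pairs [set: 'I_n]%SET)
    <= expR (B * (p `^ (1 - 1 / lam) * n%:R `^ al)).
Proof.
have [d /andP[d0 d12] Hd] := graph_containers.
have s0 : 0 < 2 * (ne H)%:R :> R by rewrite mulr_gt0 ?ltr0n.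
have [B B_gt0 HB] := gen_fun_bound d0 d12 lam1 s0 (expR_gt0 1).
exists (B * B0) => [|n p n0 p0 p1]; first by rewrite mulr_gt0.
have lam0 : 0 < lam by apply: lt_trans lam1.
have n0R : 0 < n%:R :> R by rewrite ltr0n.
(* This choice makes p * (e0 / |D|)^lam equal to (B0 * n^al / |D|)^lam, the scale of the graph
   fingerprints; p <= 1 gives e0 >= B0 * n^al, so every D with |D| > 2 * e0 has containers. *)
pose e0 := B0 * n%:R `^ al * p `^ (- (1 / lam)).
have e00 : 0 < e0 by rewrite !mulr_gt0// ?powR_gt0.
have -> : B * B0 * (p `^ (1 - 1 / lam) * n%:R `^ al) = B * (p * e0).
  have -> : p `^ (1 - 1 / lam) = p * p `^ (- (1 / lam)).
    rewrite powRD ?powRr1 ?(ltW p0)//.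
    by apply/implyP => _; rewrite gt_eqF.
  by rewrite /e0; ring.
apply: HB => //.
  by move=> I T nI TI; apply: contraNN nI; apply: containsS.
move=> D DT De.
have pl1 : 1 <= p `^ (- (1 / lam)).
  rewrite powR_expR// -[leLHS]expR0 ler_expR mulNr oppr_ge0 pmulr_rle0; first by rewrite ln_le0.
  by rewrite div1r invr_gt0.
have c0 : 0 < B0 * n%:R `^ al by apply: mulr_gt0; rewrite ?powR_gt0.
have Be : B0 * n%:R `^ al <= e0 by rewrite /e0 ler_peMr// ltW.
have De' : B0 * n%:R `^ al <= #|D|%:R by move: De e00 Be; lra.
have N0 : 0 < #|D|%:R :> R by apply: lt_trans De; rewrite mulr_gt0.
have -> : p * (e0 / #|D|%:R) `^ lam = (B0 * n%:R `^ al / #|D|%:R) `^ lam.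
  rewrite /e0 mulrAC [in LHS](@powRM _ (_ / _) (p `^ _)) ?powR_ge0//; last first.
    by rewrite ltW// divr_gt0.
  rewrite -powRrM mulNr div1r mulVf ?gt_eqF// powR_inv1 ?(ltW p0)//.
  by rewrite mulrCA divff ?gt_eqF// mulr1.
exact: Hd.
Qed.

End GraphContainers.
(** * Random graphs *)

Lemma extend_injection (U W : finType) (X Y : {set U}) (Z : {set W}) (f : U -> W) :
  X \subset Y -> {in X &, injective f} -> (forall x, x \in X -> f x \in Z) ->
  (#|Y| <= #|Z|)%N ->
  exists g : U -> W, [/\ {in X, g =1 f}, {in Y &, injective g} & forall y, y \in Y -> g y \in Z].
Proof.
move=> XY fi fZ YZ.
pose Y' := Y :\: X; pose Z' := Z :\: (f @: X)%SET.
have cYZ : (#|Y'| <= #|Z'|)%N.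
  rewrite !cardsDS//; last by apply/fintype.subsetP => _ /imsetP[x xX ->]; apply: fZ.
  by rewrite card_in_imset// leq_sub2r.
pose g x := if x \in X then f x else nth (f x) (enum Z') (index x (enum Y')).
have idx x : x \in Y -> x \notin X -> (index x (enum Y') < size (enum Z'))%N.
  move=> xY xX; apply: (@leq_trans (size (enum Y'))); last by rewrite -!cardE.
  by rewrite index_mem mem_enum !inE xX.
have gZ' x : x \in Y -> x \notin X -> g x \in Z'.
  by move=> xY xX; rewrite /g (negbTE xX) -mem_enum mem_nth// idx.
exists g; split.
- by move=> x xX; rewrite /g xX.
- have sym x y : x \in X -> y \notin X -> y \in Y -> g x = g y -> x = y.
    move=> xX yX yY gxy; have := gZ' y yY yX; rewrite -gxy /g xX inE => /andP[/negP[]].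
    exact: imset_f.
  move=> x y xY yY; have [xX|xX] := boolP (x \in X); have [yX|yX] := boolP (y \in X).
  + by rewrite /g xX yX; apply: fi.
  + exact: sym.
  + by move=> /esym /(sym _ _ yX xX xY).
  rewrite /g (negbTE xX) (negbTE yX).
  rewrite (set_nth_default (f x) (f y)) ?idx// => /eqP.
  rewrite nth_uniq ?idx ?enum_uniq// => /eqP e.
  have xE : x \in enum Y' by rewrite mem_enum !inE xX.
  have yE : y \in enum Y' by rewrite mem_enum !inE yX.
  by rewrite -(nth_index x xE) e nth_index.
- move=> y yY; have [yX|yX] := boolP (y \in X); first by rewrite /g yX fZ.
  by have := gZ' y yY yX; rewrite inE => /andP[].
Qed.

(* Isolated vertices of H matter only for graphs with fewer vertices than H:
   otherwise they can be placed on the unused vertices of F. *)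
Lemma free_not_contains (V W : finType) (H : graph V) (F : graph W) :
  Defs.free H F -> (nv H ^ 2 < ne F)%N -> ~~ contains H (edges F).
Proof.
move=> fF big; apply: contraNN fF => /existsP[f /andP[/dinjectiveP fi /forall_inP fE]].
have FW : edges F \subset pairs (vertices F) := valP F.
have vF : (#|vertices H| <= #|vertices F|)%N.
  rewrite -leq_sqr; apply: leq_trans (card_pairs (vertices F)).
  by apply: leq_trans (ltnW big) (subset_leq_card FW).
pose X := [set x in vertices H | [exists e in edges H, x \in e]]%SET.
have XV : X \subset vertices H by apply/fintype.subsetP => x; rewrite inE => /andP[].
have inX e x : e \in edges H -> x \in e -> x \in X.
  move=> eH xe; have [eV _] := edgeP eH; rewrite inE (fintype.subsetP eV)//=.
  by apply/exists_inP; exists e.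
have fX x : x \in X -> f x \in vertices F.
  rewrite inE => /andP[_ /exists_inP[e eH xe]].
  have := fintype.subsetP FW _ (fE e eH); rewrite inE => /andP[/fintype.subsetP eF _].
  by apply: eF; apply: imset_f.
have [|g [gf gi gF]] := extend_injection XV _ fX vF.
  by move=> x y xX yX; apply: fi; apply: (fintype.subsetP XV).
apply/existsP; exists [ffun x => g x]; apply/and3P; split.
- by apply/dinjectiveP => x y xH yH; rewrite !ffunE; apply: gi.
- by apply/fintype.subsetP => _ /imsetP[x xH ->]; rewrite ffunE gF.
- apply/forall_inP => e eH.
  have -> : [set [ffun x => g x] x | x in e]%SET = [set f x | x in e]%SET.
    by apply: eq_in_imset => x xe; rewrite ffunE gf// (inX e).
  exact: fE.
Qed.

(** * Exponential moment bound in G(n,p) *)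

Section Tail.
Context (R : realType) (n : nat) (p : R).
Implicit Types (I J D : {set {set 'I_n}}) (G : graph 'I_n).

Local Notation K := (pairs [set: 'I_n]%SET).

(** The weight is a product over pairs, so the sum over edge sets factorises: a pair of I
    contributes p, any other pair p + (1 - p). *)
Lemma gnp_prob_superset I : I \subset K ->
  gnp_prob p (fun G : graph 'I_n => I \subset edges G) = p ^+ #|I|.
Proof.
move=> IK; rewrite /gnp_prob (reindex_onto (@span_graph 'I_n) (@edges 'I_n))/=; last first.
  move=> G /andP[/eqP GT _]; apply: val_inj => /=.
  have GK : edges G \subset K by rewrite -GT; exact: (valP G).
  rewrite (finset.setIidPl GK) -GT /vertices /edges.
  by case: (graph_val G).
(* Zero factors encode that J lies in K and contains I, so that J can range over all sets and the
   sum distributes. *)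
transitivity (\sum_(J : {set {set 'I_n}}) \prod_(e : {set 'I_n}) (if e \in J
    then (if e \in K then p else 0)
    else (if e \in K then (if e \in I then 0 else 1 - p) else 1))).
  rewrite big_mkcond/=; apply: eq_bigr => J _; rewrite {1}/vertices/= eqxx/=.
  rewrite {1 2}/edges/=; case: ifP => [/andP[IJ /eqP JK]|nJ].
    rewrite /gnp_weight /edges/= big_mkcond/=; apply: eq_bigr => e _.
    rewrite JK; have JK' : J \subset K by rewrite -JK finset.subsetIr.
    case: (boolP (e \in J)) => eJ; first by rewrite (fintype.subsetP JK').
    case: ifP => // eK; case: ifP => // eI.
    by move: IJ => /fintype.subsetP/(_ e eI); rewrite JK (negbTE eJ).
  have [JK|/subsetPn[e eJ eK]] := boolP (J \subset K); last first.
    by rewrite (bigD1 e)//= eJ (negbTE eK) mul0r.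
  have [IJ|/subsetPn[e eI eJ]] := boolP (I \subset J).
    by move: nJ; rewrite (finset.setIidPl JK) IJ eqxx.
  by rewrite (bigD1 e)//= (negbTE eJ) (fintype.subsetP IK)// eI mul0r.
rewrite -bigA_distr -prodr_const [RHS]big_mkcond/=; apply: eq_bigr => e _.
case: (boolP (e \in I)) => eI; first by rewrite (fintype.subsetP IK)// addr0.
by case: ifP => _; rewrite ?add0r// addrC subrK.
Qed.

Lemma gnp_prob_compl (Q : graph 'I_n -> bool) :
  gnp_prob p Q = 1 - gnp_prob p (fun G => ~~ Q G).
Proof.
have := gnp_prob_superset (finset.sub0set K); rewrite cards0 expr0 => <-.
rewrite /gnp_prob [X in X - _](bigID Q)/= [X in X + _ - _](eq_bigl
  (fun G : graph 'I_n => (vertices G == [set: 'I_n]%SET) && Q G)); last first.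
  by move=> G; rewrite finset.sub0set andbT.
rewrite [X in _ + X - _](eq_bigl
  (fun G : graph 'I_n => (vertices G == [set: 'I_n]%SET) && ~~ Q G)) ?addrK//.
by move=> G; rewrite finset.sub0set andbT.
Qed.

Hypothesis p01 : 0 <= p <= 1.

Lemma gnp_weight_ge0 G : 0 <= gnp_weight p G.
Proof.
by case/andP: p01 => p0 p1; apply: prodr_ge0 => e _; case: ifP; rewrite ?subr_ge0.
Qed.

Lemma gnp_prob_ge0 (Q : graph 'I_n -> bool) : 0 <= gnp_prob p Q.
Proof. by apply: sumr_ge0 => G _; apply: gnp_weight_ge0. Qed.

(** The edges of a largest H-free subgraph serve as I. The bound nv H ^ 2 <= M allows
    [free_not_contains] and rules out an empty maximum, which would be 0. *)
Lemma ex_in_large (V : finType) (H : graph V) G (M : R) :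
  vertices G = [set: 'I_n]%SET -> (nv H ^ 2)%:R <= M -> ~~ ((ex_in G H)%:R <= M) ->
  exists I, [/\ I \subset edges G, I \subset K, ~~ contains H I & M < #|I|%:R].
Proof.
move=> GT HM; rewrite -ltNge => ML.
have [F /andP[/andP[_ FG] fF] eF] : exists2 F : graph 'I_n,
    subgraph F G && Defs.free H F & ex_in G H = ne F.
  have F0 : (0 < #|[pred F : graph 'I_n | subgraph F G && Defs.free H F]|)%N.
    rewrite lt0n; apply: contraTneq ML => c0.
    rewrite /ex_in big_pred0 ?ltNge ?negbK ?(le_trans _ HM)//.
    exact: card0_eq.
  have [F FF eF] := eq_bigmax_cond (@ne _) F0.
  by exists F.
have GK : edges G \subset K by rewrite -GT; exact: (valP G).
rewrite eF in ML; exists (edges F); split => //.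
  exact: fintype.subset_trans GK.
apply: free_not_contains fF _; rewrite -(ltr_nat R).
exact: le_lt_trans ML.
Qed.

(** Sets I with more than M edges have exp(|I| - M) >= 1, so weighting by this factor extends the
    union bound to all I without a copy of H; each is present with probability p^|I|. *)
Lemma ex_in_tail (V : finType) (H : graph V) (M : R) :
  (nv H ^ 2)%:R <= M ->
  gnp_prob p (fun G : graph 'I_n => ~~ ((ex_in G H)%:R <= M)) <=
  expR (- M) * gen_fun (fun I => ~~ contains H I) (expR 1 * p) K.
Proof.
move=> HM.
apply: (@le_trans _ _ (\sum_(G : graph 'I_n | vertices G == [set: 'I_n]%SET)
    \sum_(I : {set {set 'I_n}} | [&& I \subset K, ~~ contains H I & I \subset edges G])
      gnp_weight p G * expR (#|I|%:R - M))).
  rewrite /gnp_prob [leLHS]big_mkcond [leRHS]big_mkcond; apply: ler_sum => G _.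
  have pos : 0 <= \sum_(I : {set {set 'I_n}} |
      [&& I \subset K, ~~ contains H I & I \subset edges G])
      gnp_weight p G * expR (#|I|%:R - M).
    by apply: sumr_ge0 => I _; rewrite mulr_ge0 ?expR_ge0 ?gnp_weight_ge0.
  case: (boolP (vertices G == _)) => //= /eqP GT; case: ifP => // large.
  have [I [IG IK fI MI]] := ex_in_large GT HM large.
  rewrite (bigD1 I)/= ?IG ?IK ?fI//.
  apply: (@le_trans _ _ (gnp_weight p G * expR (#|I|%:R - M))).
    by rewrite ler_peMr ?gnp_weight_ge0// -[leLHS]expR0 ler_expR subr_ge0 ltW.
  by rewrite lerDl; apply: sumr_ge0 => J _; rewrite mulr_ge0 ?expR_ge0 ?gnp_weight_ge0.
rewrite (exchange_big_dep (fun I => (I \subset K) && ~~ contains H I))/=; last first.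
  by move=> G I _ /and3P[-> ->].
rewrite /gen_fun mulr_sumr; apply: ler_sum => I /andP[IK fI].
rewrite -mulr_suml expRD [_ * expR (- M)]mulrC mulrCA ler_wpM2l ?expR_ge0//.
rewrite exprMn -expRM_natl mulr1 mulrC ler_wpM2l ?expR_ge0//.
rewrite -gnp_prob_superset// /gnp_prob le_eqVlt; apply/orP; left; apply/eqP.
by apply: eq_bigl => G; rewrite IK fI.
Qed.

End Tail.

(** * Comparison with the claimed order of magnitude *)

Section Assembly.
Context (R : realType) (V : finType) (H : graph V) (al : R).
Hypotheses (Hcyc : has_cycle H) (al0 : 0 < al).

Let mu := m2 R H.
Let s := 1 - 1 / lambda al H.

Definition turan_scale (n : nat) (p : R) : R :=
  if p <= n%:R `^ (- (1 / mu)) then n%:R `^ (2 - 1 / mu)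
  else p `^ s * n%:R `^ al.

Lemma random_turan_boundE (C : R) (n : nat) (p : R) :
  random_turan_bound H al C n p = C * turan_scale n p.
Proof. by rewrite /random_turan_bound /turan_scale; case: ifP => _; rewrite ?mulrA. Qed.

Let mu1 : 1 <= mu. Proof. exact: m2_ge1. Qed.
Let mu0 : 0 < mu. Proof. exact: lt_le_trans mu1. Qed.
Let sE : s = 1 - mu * (2 - al).
Proof. by rewrite /s /lambda !div1r invrK. Qed.

Section FixedN.
Context (n : nat) (p : R).
Hypotheses (n0 : (0 < n)%N) (p01 : 0 <= p <= 1).

Let n1 : 1 <= n%:R :> R. Proof. by rewrite ler1n. Qed.
Let nR0 : 0 < n%:R :> R. Proof. by rewrite ltr0n. Qed.

Lemma low_scale_ge : n%:R <= n%:R `^ (2 - 1 / mu) :> R.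
Proof.
rewrite -[leLHS]powRr1; last exact: ltW.
rewrite ler_powR//; have : 1 / mu <= 1 by rewrite div1r invf_le1.
by lra.
Qed.

Lemma dense_p : ~~ (p <= n%:R `^ (- (1 / mu))) -> n%:R `^ (- (1 / mu)) <= p /\ 0 < p.
Proof.
rewrite -ltNge => h; split; first exact: ltW.
by apply: le_lt_trans h; apply: powR_ge0.
Qed.

(** For s >= 0 the dense scale increases with p, and at the threshold n^(-1 / mu) it equals n^(2 - 1
    / mu). *)
Lemma turan_scale_ge : 0 <= s -> n%:R <= turan_scale n p.
Proof.
move=> s0; rewrite /turan_scale; case: ifPn => [_|/dense_p[np p0]]; first exact: low_scale_ge.
apply: le_trans low_scale_ge _.
apply: (@le_trans _ _ ((n%:R `^ (- (1 / mu))) `^ s * n%:R `^ al)).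
  rewrite -powRrM -powRD; last by apply/implyP => _; rewrite gt_eqF.
  rewrite le_eqVlt; apply/orP; left; apply/eqP; congr (_ `^ _); rewrite sE.
  by field; rewrite gt_eqF.
rewrite ler_wpM2r ?powR_ge0// ge0_ler_powR ?nnegrE ?powR_ge0//.
exact: ltW.
Qed.

(** For al >= 2 above the threshold, s = 1 + mu * (al - 2) and p >= n^(-1 / mu) give p^s * n^al >= p
    * n^2. *)
Lemma edges_scale : p <= n%:R `^ (- (1 / mu)) \/ 2 <= al ->
  p * n%:R ^+ 2 <= turan_scale n p.
Proof.
rewrite /turan_scale; case: ifPn => [np _|nnp]; last case=> [np|al2].
- rewrite addrC powRD; last by apply/implyP => _; rewrite gt_eqF.
  by rewrite powR_mulrn ?(ltW nR0)// ler_wpM2r// exprn_ge0 ?ltW.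
- by [].
- have [np p0] := dense_p nnp.
  rewrite sE (_ : 1 - mu * (2 - al) = 1 + mu * (al - 2)); last by ring.
  rewrite powRD; last by apply/implyP => _; rewrite gt_eqF.
  rewrite powRr1 ?(ltW p0)// -mulrA ler_pM2l//.
  have -> : n%:R ^+ 2 = n%:R `^ (- (1 / mu) * (mu * (al - 2))) * n%:R `^ al :> R.
    rewrite -powRD; last by apply/implyP => _; rewrite gt_eqF.
    rewrite -powR_mulrn ?(ltW nR0)//; congr (_ `^ _).
    by field; rewrite gt_eqF.
  rewrite [in leLHS]powRrM ler_wpM2r ?powR_ge0// ge0_ler_powR ?nnegrE ?powR_ge0 ?(ltW p0)//.
  by rewrite mulr_ge0 ?(ltW mu0)// subr_ge0.
Qed.

Lemma edges_gen_fun (P : pred {set {set 'I_n}}) :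
  p <= n%:R `^ (- (1 / mu)) \/ 2 <= al ->
  gen_fun P (expR 1 * p) (pairs [set: 'I_n]%SET) <= expR (expR 1 * turan_scale n p).
Proof.
move=> /edges_scale h; have /andP[p0 _] := p01.
apply: le_trans (gen_fun_le _ _ _) _; first by rewrite mulr_ge0 ?expR_ge0.
rewrite ler_expR -mulrA ler_pM2l ?expR_gt0//; apply: le_trans h.
rewrite ler_wpM2l// -natrX ler_nat.
by have := card_pairs [set: 'I_n]%SET; rewrite cardsT card_ord.
Qed.

(** With L the scale, the surplus 1 in C - b leaves exp(-L) <= exp(-n) <= 1 / (n + 1); the summand
    nv H ^ 2 makes C * L large enough for [ex_in_tail]. *)
Lemma tail_from_gen_fun (b C : R) :
  n%:R <= turan_scale n p -> b + 1 + (nv H ^ 2)%:R <= C -> 0 <= b ->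
  gen_fun (fun I : {set {set 'I_n}} => ~~ contains H I) (expR 1 * p)
    (pairs [set: 'I_n]%SET) <= expR (b * turan_scale n p) ->
  gnp_prob p (fun G : graph 'I_n => ~~ ((ex_in G H)%:R <= random_turan_bound H al C n p))
    <= n.+1%:R^-1.
Proof.
move=> + bC b0; set L := turan_scale n p => nL hgen.
have h0 : 0 <= (nv H ^ 2)%:R :> R by [].
have L1 : 1 <= L by exact: le_trans n1 nL.
have C0 : 0 <= C by move: bC b0 h0; lra.
have hM : (nv H ^ 2)%:R <= C * L.
  apply: (@le_trans _ _ (C * 1)); last by rewrite ler_wpM2l.
  by rewrite mulr1; move: bC b0; lra.
rewrite random_turan_boundE -/L.
apply: le_trans (ex_in_tail n p01 hM) _.
apply: (@le_trans _ _ (expR (- (C * L)) * expR (b * L))).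
  by rewrite ler_wpM2l ?expR_ge0.
rewrite -expRD; apply: (@le_trans _ _ (expR (- n%:R))).
  rewrite ler_expR.
  have : (b + 1) * L <= C * L by rewrite ler_wpM2r ?(le_trans _ L1)//; move: bC h0; lra.
  by rewrite mulrDl mul1r; move: nL; lra.
by rewrite expRN lef_pV2 ?posrE ?expR_gt0// -natr1 addrC expR_ge1Dx.
Qed.

End FixedN.

Lemma tail_bound (A : R) : 0 < A ->
  (forall n : nat, (ex_num n H)%:R <= A * n%:R `^ al) ->
  exists2 C : R, 0 < C & forall (n : nat) (p : R), (0 < n)%N -> 0 <= p <= 1 ->
    gnp_prob p (fun G : graph 'I_n =>
      ~~ ((ex_in G H)%:R <= random_turan_bound H al C n p)) <= n.+1%:R^-1.
Proof.
move=> A0 exA.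
have h0 : 0 <= (nv H ^ 2)%:R :> R by [].
(* Containers serve the case al < 2 and s > 0, where s > 0 means lambda > 1; otherwise B = 0 is a
   placeholder. *)
have [B B0 HB] : exists2 B : R, 0 <= B & al < 2 -> 0 < s ->
    forall (n : nat) (p : R), (0 < n)%N -> 0 < p -> p <= 1 ->
    gen_fun (fun I : {set {set 'I_n}} => ~~ contains H I) (expR 1 * p)
      (pairs [set: 'I_n]%SET) <= expR (B * (p `^ s * n%:R `^ al)).
  have [al2|al2] := ltP al 2; last by exists 0.
  have [s0|s0] := ltP 0 s; last by exists 0.
  have H0 : (0 < ne H)%N.
    case: Hcyc => -[|x [|y t]] [//= _ /andP[/andP[xy _] _]].
    by rewrite /ne card_gt0; apply/set0Pn; exists [set x; y]%SET.
  have lam1 : 1 < lambda al H.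
    have l0 : 0 < lambda al H by rewrite /lambda div1r invr_gt0 mulr_gt0// subr_gt0.
    by move: s0; rewrite /s subr_gt0 ltr_pdivrMr// mul1r.
  have exA1 n : (ex_num n H)%:R <= (1 + A) * n%:R `^ al.
    by apply: le_trans (exA n) _; rewrite ler_wpM2r ?powR_ge0// lerDr.
  have A1 : 1 <= 1 + A by rewrite lerDl ltW.
  have [B B0 HB] := contains_gen_fun H0 mu1 al2 A1 exA1 lam1.
  by exists B => //; apply: ltW.
have e0 := expR_gt0 (1 : R).
(* One constant covers all cases: exp(1) for the plain edge count, B for containers, A for the
   deterministic bound. *)
exists (expR 1 + B + 1 + (nv H ^ 2)%:R + A); first by move: h0 B0 A0 e0; lra.
move=> n p n0 p01; have /andP[p0 p1] := p01.
have [np|np] := boolP (p <= n%:R `^ (- (1 / mu))).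
  apply: (@tail_from_gen_fun n p n0 p01 (expR 1)); rewrite ?(ltW e0)//.
  - by rewrite /turan_scale np; exact: low_scale_ge.
  - by move: B0 A0; lra.
  - by apply: edges_gen_fun => //; left.
have [_ pp0] := dense_p np.
have [s0|s0] := leP s 0; last first.
  have nL : n%:R <= turan_scale n p by apply: turan_scale_ge => //; exact: ltW.
  have [al2|al2] := leP 2 al.
    apply: (@tail_from_gen_fun n p n0 p01 (expR 1)); rewrite ?(ltW e0)//.
      by move: B0 A0; lra.
    by apply: edges_gen_fun => //; right.
  apply: (@tail_from_gen_fun n p n0 p01 B) => //.
    by move: e0 A0; lra.
  by rewrite /turan_scale (negbTE np); apply: HB.
(* Here s <= 0 and p <= 1 give p^s >= 1, so the bound is at least ex(n, H) and the bad event is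
   empty. *)
rewrite /gnp_prob big_pred0 ?invr_ge0// => G; apply/negP => /andP[/eqP GT].
set C := _ + A; have C0 : 0 < C by rewrite /C; move: h0 B0 A0 e0; lra.
have n1 : 1 <= n%:R `^ al.
  by rewrite powR_expR ?ltr0n// -[leLHS]expR0 ler_expR mulr_ge0 ?(ltW al0)// ln_ge0// ler1n.
have CnL : C * n%:R `^ al <= random_turan_bound H al C n p.
  rewrite random_turan_boundE ler_pM2l// /turan_scale (negbTE np) ler_peMl ?powR_ge0//.
  rewrite powR_expR// -[leLHS]expR0 ler_expR -mulrNN mulr_ge0 ?oppr_ge0//.
  by rewrite ln_le0.
have h2C : (nv H ^ 2)%:R <= random_turan_bound H al C n p.
  apply: le_trans CnL; apply: (@le_trans _ _ (C * 1)).
    by rewrite mulr1 /C; move: e0 B0 A0; lra.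
  by rewrite ler_pM2l.
case/(ex_in_large GT h2C) => I [_ IK fI].
apply/negP; rewrite -leNgt; apply: le_trans CnL.
apply: (@le_trans _ _ (A * n%:R `^ al)); last first.
  by rewrite ler_pM2r ?(lt_le_trans ltr01)// /C; move: e0 B0 h0; lra.
apply: le_trans (exA n); rewrite ler_nat leqNgt; apply: contraNN fI.
by apply: ex_num_contains IK; rewrite cardsT card_ord.
Qed.
End Assembly.

(** * Passage to the limit *)

Local Open Scope classical_set_scope.

Theorem theorem2p4 (R : realType) (V : finType) (H : graph V) (h l : nat)
    (Hh : nv H = h) (Hl : ne H = l)
    (Hbip : bipartite H) (Hcyc : has_cycle H)
    (alpha : R) (Halpha : 0 < alpha) :
  exists C : R, 0 < C /\
    forall A : R, 0 < A ->
      (forall n : nat, (ex_num n H)%:R <= A * n%:R `^ alpha) ->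
    forall p : nat -> R, (forall n : nat, 0 <= p n <= 1) ->
      (fun n : nat =>
         gnp_prob (p n) (fun G : graph 'I_n =>
           (ex_in G H)%:R <= random_turan_bound H alpha C n (p n)))
        @ \oo --> (1 : R).
Proof.
(* C may depend on A: it is chosen from one admissible A, if there is any. *)
have [[A [A0 exA]]|noA] := pselect (exists A : R, 0 < A /\
    forall n : nat, (ex_num n H)%:R <= A * n%:R `^ alpha); last first.
  by exists 1; split=> // A A0 exA; case: noA; exists A.
have [C C0 HC] := tail_bound Hcyc Halpha A0 exA.
exists C; split=> // _ _ _ p p01.
apply: (@squeeze_cvgr _ _ _ _ (fun n : nat => 1 - harmonic n) (fun=> 1)).
- near=> n; have n0 : (0 < n)%N by near: n; exists 1%N.
  rewrite gnp_prob_compl lerD2l lerN2 HC//= gerBl.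
  exact: gnp_prob_ge0.
- rewrite -[X in _ --> X]subr0; apply: cvgB; first exact: cvg_cst.
  exact: cvg_harmonic.
- exact: cvg_cst.
Unshelve. all: by end_near.
Qed.
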